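(* \textsc{Multi-Layer Cluster Editing} (MLCE) admits a kernel of size $O(\ell^3\cdot (k+d)^4)$ and \textsc{Temporal Cluster Editing} (TCE) admits a kernel of size $O(\ell^3\cdot(k+d\cdot \ell)^4)$ (with respect to the combined parameter $(k,d,\ell)$). Both kernels can be computed in $O(\ell\cdot n^3)$ time, where $n$ is the number of vertices.
   Context: A multi-layer (resp. temporal) graph is a set (resp. sequence) of graphs $G_1=(V,E_1),\dots,G_\ell=(V,E_\ell)$ on the same vertex set $V$, $n=|V|$. An edit for a graph $G=(V,E)$ is an unordered pair of vertices; a set $M$ of edits is a cluster editing set for $G$ if $(V,E\oplus M)$ is a disjoint union of cliques ($\oplus$ is symmetric difference). A clustering is a sequence $(M_i)_{i\in[\ell]}$ with $M_i$ a cluster editing set for $G_i$; it is $k$-bounded if $|M_i|\le k$ for all $i$. Let $G_i'=(V,E_i\oplus M_i)$. The clustering is totally $d$-consistent if there is $D\subseteq V$, $|D|\le d$, with $G_i'[V\setminus D]=G_j'[V\setminus D]$ for all $i,j$; it is temporally $d$-consistent if there are $D_1,\dots,D_{\ell-1}\subseteq V$ of size at most $d$ with $G_i'[V\setminus D_i]=G_{i+1}'[V\setminus D_i]$ for all $i\in[\ell-1]$. MLCE asks, given the layers and $k,d$, whether a totally $d$-consistent $k$-bounded clustering exists; TCE asks the same for a temporally $d$-consistent $k$-bounded clustering. A kernel of size $s$ is a polynomial-time algorithm mapping each instance to an equivalent instance of the same problem whose encoding size is at most $s$. *)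

(* Defs.v *)
From mathcomp Require Import all_boot.

Set Implicit Arguments.
Unset Strict Implicit.
Unset Printing Implicit Defensive.

(** * Multi-layer and temporal cluster editing *)

Section ClusterEditing.
Variable V : finType.
Implicit Types (E M : {set {set V}}) (D : {set V}).

Definition is_pairs (E : {set {set V}}) : bool := [forall e in E, #|e| == 2].

Record graph := Graph { edges : {set {set V}}; edges_pairs : is_pairs edges }.

Definition symdiff (E M : {set {set V}}) := (E :\: M) :|: (M :\: E).

(* The edges of the subgraph induced by the vertices outside D. *)
Definition edges_outside (D : {set V}) (E : {set {set V}}) :=
  [set e in E | e \subset ~: D].

Definition disjoint_union_of_cliques (E : {set {set V}}) : Prop :=
  exists2 P : {set {set V}}, partition P [set: V] &
    E = [set e : {set V} | (#|e| == 2) && [exists B in P, e \subset B]].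

Definition cluster_editing_set (G : graph) (M : {set {set V}}) : Prop :=
  is_pairs M /\ disjoint_union_of_cliques (symdiff (edges G) M).

Section Layers.
Variables (l : nat) (G : 'I_l -> graph) (M : 'I_l -> {set {set V}}).

Definition edited (i : 'I_l) : {set {set V}} := symdiff (edges (G i)) (M i).

Definition clustering : Prop := forall i, cluster_editing_set (G i) (M i).

Definition bounded (k : nat) : Prop := forall i, #|M i| <= k.

Definition totally_consistent (d : nat) : Prop :=
  exists2 D : {set V}, #|D| <= d &
    forall i j, edges_outside D (edited i) = edges_outside D (edited j).

Definition temporally_consistent (d : nat) : Prop :=
  exists2 D : 'I_l.-1 -> {set V}, (forall h, #|D h| <= d) &
    forall (h : 'I_l.-1) (i j : 'I_l), i = h :> nat -> j = h.+1 :> nat ->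
      edges_outside (D h) (edited i) = edges_outside (D h) (edited j).

End Layers.
End ClusterEditing.

Record instance := Instance {
  nvert : nat;
  nlayer : nat;
  budget : nat;    (* the parameter k *)
  distance : nat;  (* the parameter d *)
  layer : 'I_nlayer -> graph 'I_nvert }.

Definition MLCE (I : instance) : Prop :=
  exists M : 'I_(nlayer I) -> {set {set 'I_(nvert I)}},
    [/\ clustering (@layer I) M, bounded M (budget I)
      & totally_consistent (@layer I) M (distance I)].

Definition TCE (I : instance) : Prop :=
  exists M : 'I_(nlayer I) -> {set {set 'I_(nvert I)}},
    [/\ clustering (@layer I) M, bounded M (budget I)
      & temporally_consistent (@layer I) M (distance I)].

(** * Encoding of instances *)

(* The four numbers, followed by the row-major 0/1 adjacency matrices of the
   layers; one machine word per item. *)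
Definition adjacency (I : instance) (i : 'I_(nlayer I)) : seq nat :=
  [seq nat_of_bool ([set u; v] \in edges (layer i))
     | u <- enum 'I_(nvert I), v <- enum 'I_(nvert I)].

Definition words (I : instance) : seq nat :=
  [:: nvert I; nlayer I; budget I; distance I]
    ++ flatten [seq adjacency i | i <- enum 'I_(nlayer I)].

Definition bit_length (x : nat) : nat := (trunc_log 2 x).+1.

Definition encoding_size (I : instance) : nat :=
  \sum_(w <- words I) bit_length w.

(** * Word RAM programs *)

Inductive binop := Add | Sub | Mul | Div | Eq | Lt.

Inductive expr :=
  | Const of nat
  | Reg of nat
  | Fetch of expr
  | Bin of binop & expr & expr.

Inductive cmd :=
  | Skip
  | Assign of nat & expr
  | Store of expr & expr
  | Seq of cmd & cmd
  | If of expr & cmd & cmd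
  | While of expr & cmd.

Record state := State { regs : nat -> nat; mem : nat -> nat }.

Definition upd (f : nat -> nat) (a x : nat) : nat -> nat :=
  fun b => if b == a then x else f b.

Definition eval_binop (o : binop) (x y : nat) : nat :=
  match o with
  | Add => x + y
  | Sub => x - y
  | Mul => x * y
  | Div => x %/ y
  | Eq => x == y
  | Lt => x < y
  end.

Section Semantics.
(* A machine word holds the numbers smaller than B. A program producing a larger
   value, even as an address or an intermediate result, has no execution. *)
Variable B : nat.

Definition word (x : nat) : option nat := if x < B then Some x else None.

Fixpoint eval (s : state) (e : expr) : option nat :=
  match e with
  | Const x => word x
  | Reg r => word (regs s r)
  | Fetch a => if eval s a is Some x then word (mem s x) else None
  | Bin o a b =>
      if eval s a is Some x then
        if eval s b is Some y then word (eval_binop o x y) else None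
      else None
  end.

Fixpoint expr_cost (e : expr) : nat :=
  match e with
  | Const _ | Reg _ => 1
  | Fetch a => (expr_cost a).+1
  | Bin _ a b => (expr_cost a + expr_cost b).+1
  end.

(* [exec p s t s']: started in s, p halts in s' after t unit-cost operations. *)
Inductive exec : cmd -> state -> nat -> state -> Prop :=
  | ExecSkip s : exec Skip s 1 s
  | ExecAssign r e s x :
      eval s e = Some x ->
      exec (Assign r e) s (expr_cost e).+1 (State (upd (regs s) r x) (mem s))
  | ExecStore a e s y x :
      eval s a = Some y -> eval s e = Some x ->
      exec (Store a e) s (expr_cost a + expr_cost e).+1
        (State (regs s) (upd (mem s) y x))
  | ExecSeq p q s1 s2 s3 t1 t2 :
      exec p s1 t1 s2 -> exec q s2 t2 s3 ->
      exec (Seq p q) s1 (t1 + t2) s3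
  | ExecIf e p q s x t s' :
      eval s e = Some x -> exec (if x != 0 then p else q) s t s' ->
      exec (If e p q) s (expr_cost e + t).+1 s'
  | ExecWhileStop e p s :
      eval s e = Some 0 ->
      exec (While e p) s (expr_cost e).+1 s
  | ExecWhileStep e p s1 x s2 s3 t1 t2 :
      eval s1 e = Some x -> x != 0 ->
      exec p s1 t1 s2 -> exec (While e p) s2 t2 s3 ->
      exec (While e p) s1 (expr_cost e + t1 + t2).+1 s3.

End Semantics.

(* Words of O(log(n + l + k + d)) bits. *)
Definition word_bound (c : nat) (I : instance) : nat :=
  (nvert I + nlayer I + budget I + distance I + 2) ^ c.

Definition initial (I : instance) : state :=
  State (fun _ => 0) (fun a => nth 0 (words I) a).

(* On halting, register 0 holds the address at which the output starts. *)
Definition outputs (s : state) (J : instance) : Prop :=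
  forall a, a < size (words J) -> mem s (regs s 0 + a) = nth 0 (words J) a.

Definition computes_in_time (p : cmd) (c : nat)
    (f : instance -> instance) (time : instance -> nat) : Prop :=
  forall I, exists t s,
    [/\ exec (word_bound c I) p (initial I) t s, outputs s (f I) & t <= time I].

(** * Kernels *)

(* The successor lets the bound be a positive constant where g vanishes. *)
Definition bigO (f g : instance -> nat) : Prop :=
  exists C, forall I, f I <= C * (g I).+1.

Definition polynomial (f : instance -> nat) : Prop :=
  exists a, bigO f (fun I => encoding_size I ^ a).

Definition kernelization (Q : instance -> Prop)
    (f : instance -> instance) (time : instance -> nat) : Prop :=
  [/\ exists p c, computes_in_time p c f time,
      polynomial time
    & forall I, Q I <-> Q (f I)].

(* The size bound is a function of k, d, l, the time bound of n, l. *)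
Definition admits_kernel (Q : instance -> Prop)
    (size_bound : nat -> nat -> nat -> nat) (time_bound : nat -> nat -> nat) :
    Prop :=
  exists f time,
    [/\ kernelization Q f time,
        bigO (fun I => encoding_size (f I))
             (fun I => size_bound (budget I) (distance I) (nlayer I))
      & bigO time (fun I => time_bound (nvert I) (nlayer I))].

(* Main.v *)
(* Call two vertices twins if they have the same closed neighbourhood in every
   layer. A set of at least k + 2 twins is not touched by any solution, so every
   twin class may be cut down to X + 2 >= max(k + 2, d + 1) vertices; a twin class
   that is a connected component in all layers may be removed. In a yes-instance,
   every other untouched and undeleted vertex lies, in some layer, in the edited
   cluster of a deleted vertex or of a vertex edited in that layer, and these
   clusters meet the remaining vertices in twins; this leaves O(l X^2) vertices,
   where X = k + d for MLCE and X = k + d l for TCE (the union of the deletion sets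
   of a temporal solution works for all layers). Comparing all closed
   neighbourhoods takes O(l n^3) operations. *)

Require Import Defs.
From mathcomp Require Import all_boot.
From mathcomp Require Import zify.

Set Implicit Arguments.
Unset Strict Implicit.
Unset Printing Implicit Defensive.

(** * Cluster graphs through closed adjacency *)

(** The two problems differ only in which pairs of layers are compared outside which deletion set.
    The equivalence is therefore proved once, for [solvable], with that relation as the parameter
    [R]; deletion sets are merged into one only for the counting bound.

    The delicate direction is lifting a solution of the kernel. A dropped vertex has to imitate a
    kept twin that is neither edited nor deleted. Different deletion sets may call for different
    twins, which is harmless because untouched twins share their edited neighbourhoods.

    A time bound is a statement about a machine, so a concrete word RAM program is verified as well,
    including that no intermediate value overflows a word. The bound [l * n ^ 3] has no additive
    term in [n]. This makes the case of no layers special: every vertex is then vacuously isolated,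
    the kernel is the empty instance, and the program must not loop over the vertices.

    Graphs are handled through the closed adjacency [cadj], which turns being a cluster graph into
    transitivity and being twins into equality of rows. *)

Definition cadj (V : finType) (E : {set {set V}}) (x y : V) : bool :=
  (x == y) || ([set x; y] \in E).

Section ClosedAdjacency.
Variable V : finType.
Implicit Types (E M : {set {set V}}) (D : {set V}).

Lemma cadj_refl E x : cadj E x x.
Proof. by rewrite /cadj eqxx. Qed.

Lemma cadj_sym E x y : cadj E x y = cadj E y x.
Proof. by rewrite /cadj eq_sym setUC. Qed.

Lemma pair_card (x y : V) : x != y -> #|[set x; y]| == 2.
Proof. by move=> xy; rewrite cards2 xy. Qed.

Lemma is_pairs_loop E x : is_pairs E -> [set x; x] \notin E.
Proof.
move=> /forall_inP pE; apply/negP => /pE.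
by rewrite setUid cards1.
Qed.

Lemma is_pairs_mem E x y : is_pairs E -> [set x; y] \in E = (x != y) && cadj E x y.
Proof.
by move=> pE; rewrite /cadj; case: eqP => [->|//]; rewrite (negPf (is_pairs_loop y pE)).
Qed.

Lemma is_pairs_symdiff E M : is_pairs E -> is_pairs M -> is_pairs (symdiff E M).
Proof.
move=> /forall_inP pE /forall_inP pM; apply/forall_inP => e.
by rewrite !inE => /orP[/andP[_ /pE]|/andP[_ /pM]].
Qed.

Lemma mem_symdiff E M e : (e \in symdiff E M) = (e \in E) (+) (e \in M).
Proof. by rewrite !inE; case: (e \in E) (e \in M) => [] []. Qed.

Lemma cadj_symdiff E M x y : is_pairs M ->
  cadj (symdiff E M) x y = cadj E x y (+) ([set x; y] \in M).
Proof.
move=> pM; rewrite /cadj mem_symdiff; case: eqP => [->|//].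
by rewrite (negPf (is_pairs_loop y pM)).
Qed.

Lemma edges_outsideP D E E' : is_pairs E -> is_pairs E' ->
  edges_outside D E = edges_outside D E' <->
  (forall x y, x \notin D -> y \notin D -> cadj E x y = cadj E' x y).
Proof.
move=> pE pE'; split=> [eqE x y xD yD|eqE].
  rewrite /cadj; case: eqP => //= _.
  have := congr1 (fun A : {set {set V}} => [set x; y] \in A) eqE.
  by rewrite /edges_outside !inE subUset !sub1set !inE xD yD !andbT.
apply/setP=> e; rewrite !inE; case: (boolP (e \subset ~: D)) => [eD|]; last first.
  by rewrite !andbF.
rewrite !andbT; case: (boolP (#|e| == 2)) => [/cards2P[x [y [xy def_e]]]|e2]; last first.
  move/forall_inP: pE => pE; move/forall_inP: pE' => pE'.
  by rewrite (negPf (contra (pE e) e2)) (negPf (contra (pE' e) e2)).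
move: eD; rewrite def_e subUset !sub1set !inE => /andP[xD yD].
by rewrite !is_pairs_mem // eqE.
Qed.

(** Reflexivity and symmetry are built into [cadj], so transitivity alone makes it an equivalence
    relation, and its classes are the clusters. *)
Lemma cliquesP E :
  disjoint_union_of_cliques E <-> is_pairs E /\ transitive (cadj E).
Proof.
split=> [[P /and3P[/eqP coverP trivP _] ->]|[pE trE]].
  have cadjE x y :
      cadj [set e : {set V} | (#|e| == 2) && [exists B in P, e \subset B]] x y
      = (y \in pblock P x).
    have xP : x \in cover P by rewrite coverP inE.
    have yP : y \in cover P by rewrite coverP inE.
    rewrite /cadj; case: eqP => [<-|/eqP xy]; first by rewrite mem_pblock xP.
    rewrite inE pair_card //=; apply/exists_inP/idP => [[B BP]|yx].
      rewrite subUset !sub1set => /andP[xB yB].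
      by rewrite (def_pblock trivP BP xB).
    exists (pblock P x); first exact: pblock_mem.
    by rewrite subUset !sub1set mem_pblock xP.
  split; first by apply/forall_inP => e; rewrite inE => /andP[].
  move=> y x z; rewrite !cadjE => yx zy.
  have xP : x \in cover P by rewrite coverP inE.
  by rewrite -(def_pblock trivP (pblock_mem xP) yx).
have eqR : {in [set: V] & &, equivalence_rel (cadj E)}.
  move=> x y z _ _ _; split; first exact: cadj_refl.
  move=> xy; apply/idP/idP; last exact: trE.
  by apply: trE; rewrite cadj_sym.
exists (equivalence_partition (cadj E) [set: V]).
  exact: equivalence_partitionP.
apply/setP=> e; rewrite inE; case: (boolP (#|e| == 2)) => [|e2]; last first.
  by move/forall_inP: pE => pE; rewrite (negPf (contra (pE e) e2)).
move=> /cards2P[x [y [xy ->]]] /=; rewrite is_pairs_mem // xy /=.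
apply/idP/exists_inP => [cxy|[B]].
  exists [set z in [set: V] | cadj E x z].
    by apply/imsetP; exists x.
  by rewrite subUset !sub1set !inE cadj_refl.
case/imsetP=> z _ ->; rewrite subUset !sub1set !inE => /andP[zx zy].
by apply: trE zy; rewrite cadj_sym.
Qed.

End ClosedAdjacency.

(** * Lifting and restricting solutions *)

Section Solvable.
Variables (V : finType) (l : nat) (G : 'I_l -> graph V).
Variables (H : Type) (R : H -> 'I_l -> 'I_l -> Prop) (k d : nat).

(* [R] lists the pairs of layers compared outside each deletion set. *)
Definition consistent_along (M : 'I_l -> {set {set V}}) : Prop :=
  exists2 D : H -> {set V}, (forall h, #|D h| <= d) &
    forall h i j, R h i j ->
      edges_outside (D h) (edited G M i) = edges_outside (D h) (edited G M j).

Definition solvable : Prop :=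
  exists M, [/\ clustering G M, bounded M k & consistent_along M].

Definition layer_adj (i : 'I_l) : rel V := cadj (edges (G i)).

Definition twin (u v : V) : bool :=
  [forall i, forall w, layer_adj i u w == layer_adj i v w].

(** All neighbours of [v] in any layer are its twins. Equivalently, in every layer the twin class of
    [v] is a clique and a connected component. *)
Definition isolated (v : V) : bool :=
  [forall u, [exists i, layer_adj i u v] ==> twin u v].

Lemma twinP u v : reflect (forall i, layer_adj i u =1 layer_adj i v) (twin u v).
Proof.
apply: (iffP forallP) => [uv i w|uv i]; first by have /forallP/(_ w)/eqP := uv i.
by apply/forallP=> w; rewrite uv.
Qed.

Lemma twin_sym u v : twin u v = twin v u.
Proof. by apply/twinP/twinP => uv i w; rewrite uv. Qed.

Lemma twin_trans : transitive twin.
Proof.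
move=> v u w /twinP uv /twinP vw; apply/twinP => i x.
exact: etrans (uv i x) (vw i x).
Qed.

Lemma twin_isolated u v : twin u v -> isolated v -> isolated u.
Proof.
move=> uv /forallP isov; apply/forallP => w; apply/implyP => /existsP[i wu].
rewrite twin_sym in uv; apply: (twin_trans _ uv).
apply: (implyP (isov w)); apply/existsP; exists i.
have /twinP/(_ i w) := uv; rewrite /layer_adj cadj_sym => ->.
by rewrite cadj_sym.
Qed.

Lemma isolated_adj v i w : isolated v -> layer_adj i v w = twin v w.
Proof.
move=> /forallP isov; apply/idP/idP => [vw|/twinP ->]; last exact: cadj_refl.
rewrite twin_sym; apply: (implyP (isov w)); apply/existsP; exists i.
by rewrite /layer_adj cadj_sym.
Qed.

End Solvable.

(** * Edits at large sets of twins *)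

Section Untouched.
Variables (V : finType) (E M : {set {set V}}) (T : {set V}) (k : nat).
Hypotheses (pE : is_pairs E) (pM : is_pairs M).
Hypothesis trE : transitive (cadj (symdiff E M)).
Hypotheses (leMk : #|M| <= k) (twinT : {in T &, forall x y, cadj E x =1 cadj E y}).

(* An edit {u, y} at a vertex u of T forces, for each further x in T, the edit
   {x, y} or the edit {x, u}. *)
Lemma untouched u y : k.+2 <= #|T| -> u \in T -> [set u; y] \notin M.
Proof.
move=> leT uT; apply/negP => uyM.
have uy : u != y by apply: contraTneq uyM => ->; exact: is_pairs_loop.
have cM x z : cadj (symdiff E M) x z = cadj E x z (+) ([set x; z] \in M).
  exact: cadj_symdiff.
pose f x := if [set x; y] \in M then [set x; y] else [set x; u].
have fM x : x \in T :\ u -> f x \in M.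
  rewrite !inE /f => /andP[xu xT]; case: ifP => // xyM.
  have cxy := twinT xT uT y.
  have cxu : cadj E x u by rewrite (twinT xT uT) cadj_refl.
  (* Otherwise [x] and [u] would share an edited cluster, while of the pairs [{x, y}] and [{u, y}],
     which agree before editing, only the second is edited. *)
  apply: contraFT xyM => xuM.
  have xu' : cadj (symdiff E M) x u by rewrite cM cxu (negPf xuM).
  have: cadj (symdiff E M) x y = cadj (symdiff E M) u y.
    by apply/idP/idP; apply: trE => //; rewrite cadj_sym.
  by rewrite !cM cxy uyM; case: (cadj E u y); case: (_ \in M).
have f_inj : {in T :\ u &, injective f}.
  move=> x x'; rewrite !inE => /andP[xu _] /andP[xu' _].
  (* Here [a] would have to equal [c], hence [y], so that [{a, y}] is a singleton and [b] equals [a]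
     after all. *)
  have key a b c : a != u -> [set a; y] = [set b; c] -> c \in [set y; u] ->
      a != b -> False.
    move=> au eqs cyu ab.
    have: a \in [set b; c] by rewrite -eqs set21.
    rewrite !inE (negPf ab) /= => /eqP ac; subst c.
    move: cyu; rewrite !inE (negPf au) orbF => /eqP ay; subst a.
    have: b \in [set y; y] by rewrite eqs set21.
    by rewrite !inE orbb eq_sym (negPf ab).
  case: (x =P x') => // /eqP xx'; rewrite /f.
  case: ifP => xM; case: ifP => xM' eqs.
  - by case: (key _ _ _ xu eqs); rewrite ?set21.
  - by case: (key _ _ _ xu eqs); rewrite ?set22.
  - by case: (key _ _ _ xu' (esym eqs)); rewrite ?set22 1?eq_sym.
  - have: x \in [set x'; u] by rewrite -eqs set21.
    by rewrite !inE (negPf xu) (negPf xx').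
have : #|f @: (T :\ u)| <= #|M|.
  by apply: subset_leq_card; apply/subsetP => _ /imsetP[x xT ->]; exact: fM.
rewrite card_in_imset // => leM.
have := cardsD1 u T; rewrite uT; lia.
Qed.

End Untouched.

(** * Solutions on induced subgraphs *)

Section Induced.
Variables (V W : finType) (g : W -> V).
Hypothesis g_inj : injective g.

Definition preim_edges (E : {set {set V}}) : {set {set W}} :=
  [set e : {set W} | g @: e \in E].

Lemma preim_edges_pairs E : is_pairs E -> is_pairs (preim_edges E).
Proof.
move=> /forall_inP pE; apply/forall_inP => e; rewrite inE => /pE.
by rewrite card_imset.
Qed.

Definition induced (G : graph V) : graph W := Graph (preim_edges_pairs (edges_pairs G)).

Lemma mem_preim_edges E a b : ([set a; b] \in preim_edges E) = ([set g a; g b] \in E).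
Proof. by rewrite inE imsetU1 imset_set1. Qed.

Lemma cadj_preim E a b : cadj (preim_edges E) a b = cadj E (g a) (g b).
Proof. by rewrite /cadj mem_preim_edges (inj_eq g_inj). Qed.

Lemma symdiff_preim E M :
  symdiff (preim_edges E) (preim_edges M) = preim_edges (symdiff E M).
Proof. by apply/setP => e; rewrite !inE. Qed.

(** Cluster graphs are closed under induced subgraphs, and pulling back edits and deletion sets
    along an injection cannot enlarge them. *)
Lemma solvable_induced l (G : 'I_l -> graph V) H (R : H -> 'I_l -> 'I_l -> Prop) k d :
  solvable G R k d -> solvable (fun i => induced (G i)) R k d.
Proof.
case=> M [clM leM [D leD consD]]; exists (fun i => preim_edges (M i)); split.
- move=> i; have [pM /cliquesP[pS trS]] := clM i.
  split; first exact: preim_edges_pairs.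
  apply/cliquesP; rewrite /= symdiff_preim; split; first exact: preim_edges_pairs.
  by move=> b a c; rewrite !cadj_preim; exact: trS.
- move=> i; apply: leq_trans (leM i).
  rewrite -(card_imset _ (imset_inj g_inj)); apply: subset_leq_card.
  by apply/subsetP => _ /imsetP[e + ->]; rewrite inE.
exists (fun h => g @^-1: D h) => [h|h i j Rij].
  apply: leq_trans (leD h); rewrite -(card_imset _ g_inj); apply: subset_leq_card.
  by apply/subsetP => _ /imsetP[a + ->]; rewrite inE.
have [pMi _] := clM i; have [pMj _] := clM j.
have pe i' : is_pairs (M i') -> is_pairs (edited G M i').
  by move=> pM; apply: is_pairs_symdiff => //; exact: edges_pairs.
have pe' i' : is_pairs (M i') ->
    is_pairs (edited (fun i => induced (G i)) (fun i => preim_edges (M i)) i').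
  by move=> pM; rewrite /edited /= symdiff_preim; apply: preim_edges_pairs; exact: pe.
apply/edges_outsideP; [exact: pe'|exact: pe'|] => a b; rewrite !inE => aD bD.
have /edges_outsideP eqD := consD h i j Rij.
rewrite /edited /= !symdiff_preim !cadj_preim; apply: eqD => //; exact: pe.
Qed.

Definition lift_edits (M : {set {set W}}) : {set {set V}} := [set g @: e | e : {set W} in M].

Lemma lift_edits_pairs M : is_pairs M -> is_pairs (lift_edits M).
Proof.
move=> /forall_inP pM; apply/forall_inP => _ /imsetP[e eM ->].
by rewrite card_imset //; exact: pM.
Qed.

Lemma mem_lift_edits M a b : ([set g a; g b] \in lift_edits M) = ([set a; b] \in M).
Proof.
by rewrite -!(imset_set1 g) -imsetU mem_imset //; exact: imset_inj.
Qed.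

Lemma lift_edits_codom M x y : x \notin codom g -> [set x; y] \notin lift_edits M.
Proof.
apply: contra => /imsetP[e _ eqe].
have : x \in g @: e by rewrite -eqe set21.
by case/imsetP => a _ ->; exact: codom_f.
Qed.

Section Extend.
Variables (l : nat) (G : 'I_l -> graph V) (H : Type) (R : H -> 'I_l -> 'I_l -> Prop).
Variables (k d : nat).
Hypothesis dropped : forall v, v \notin codom g -> isolated G v \/
  exists T : {set W}, [/\ k.+2 <= #|T|, d < #|T| & {in T, forall a, twin G v (g a)}].
Hypothesis kept : forall a, ~~ isolated G (g a).

(** No edit is made at a dropped vertex. Having [k.+2] elements makes [T] untouched, and [d < #|T|]
    leaves one of them outside any deletion set; transitivity and consistency at the dropped vertex
    are inherited from it. A dropped isolated class remains a cluster of its own; by [kept] it is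
    dropped as a whole. *)
Lemma solvable_extend : solvable (fun i => induced (G i)) R k d -> solvable G R k d.
Proof.
case=> M [clM leM [D leD consD]].
pose M' i := lift_edits (M i).
have pM i : is_pairs (M i) by case: (clM i).
have pM' i : is_pairs (M' i) by exact: lift_edits_pairs.
pose c i := cadj (edited G M' i).
have cE i x y : c i x y = layer_adj G i x y (+) ([set x; y] \in M' i).
  by rewrite /c /edited cadj_symdiff.
have cS i x y : c i x y = c i y x by exact: cadj_sym.
have cg i a b : c i (g a) (g b) =
    cadj (edited (fun i => induced (G i)) M i) a b.
  by rewrite cE /edited cadj_symdiff // mem_lift_edits /= cadj_preim.
have cout i x y : x \notin codom g -> c i x y = layer_adj G i x y.
  by move=> xg; rewrite cE (negPf (lift_edits_codom _ _ xg)) addbF.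
(* Outside the isolated classes, a deleted vertex behaves in the lifted solution
   like a kept twin, which can be chosen outside a given deletion set. *)
have rep v (D' : {set W}) : #|D'| <= d -> v \notin g @: D' ->
    isolated G v /\ v \notin codom g \/
    exists2 a, a \notin D' & forall i, c i v =1 c i (g a).
  move=> leD' vD'; case: (boolP (v \in codom g)) => [/codomP[a va]|vg].
    right; exists a => [|i y]; last by rewrite va.
    by apply: contra vD' => aD'; rewrite va; exact: imset_f.
  have [isov|[T [kT dT twT]]] := dropped vg; first by left.
  right; have /subsetPn[a aT aD'] : ~~ (T \subset D').
    by apply: contraL dT => /subset_leq_card ?; lia.
  exists a => // i y; rewrite cout // cE.
  have -> : [set g a; y] \in M' i = false.
    case: (boolP (y \in codom g)) => [/codomP[b ->]|yg]; last first.
      by rewrite setUC (negPf (lift_edits_codom _ _ yg)).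
    rewrite mem_lift_edits; apply/negbTE.
    have [_ /cliquesP[_ trM]] := clM i.
    apply: (untouched _ (pM i) trM (leM i) _ _ kT aT).
      exact: edges_pairs.
    move=> x z xT zT w; rewrite /= !cadj_preim.
    have /twinP twx := twT x xT; have /twinP twz := twT z zT.
    by rewrite -!/(layer_adj G i _ _) -twx -twz.
  by rewrite addbF; move/twinP: (twT a aT) => ->.
have rep0 v : isolated G v /\ v \notin codom g \/ exists a, forall i, c i v =1 c i (g a).
  have [||?|[a _ va]] := rep v set0; rewrite ?cards0 ?imset0 ?inE //; first by left.
  by right; exists a.
have isoc i x y : isolated G x -> x \notin codom g -> c i x y = twin G x y.
  by move=> isox xg; rewrite cout // isolated_adj.
have iso_out x y : isolated G x -> twin G x y -> y \notin codom g.
  move=> isox xy; apply/negP => /codomP[b yb].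
  by have /negP := kept b; apply; rewrite -yb; apply: twin_isolated isox; rewrite twin_sym.
exists M'; split.
- move=> i; split=> //; apply/cliquesP; split.
    by apply: is_pairs_symdiff => //; exact: edges_pairs.
  rewrite -/(edited G M' i) -/(c i) => y x z.
  have trg : transitive (fun a b => c i (g a) (g b)).
    have [_ /cliquesP[_ trM]] := clM i.
    by move=> b a e; rewrite !cg; exact: trM.
  (* If one of the three vertices lies in a dropped isolated class, adjacency forces all of them
     into it; otherwise each has a kept representative with the same edited neighbours. *)
  case: (rep0 y) => [[isoy yg]|[b yb]].
    rewrite (cS i x y) (isoc i y x) // (isoc i y z) // => yx yz; rewrite isoc.
    - by apply: twin_trans yz; rewrite twin_sym.
    - by apply: twin_isolated isoy; rewrite twin_sym.
    - exact: iso_out yx.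
  case: (rep0 x) => [[isox xg]|[a xa]].
    rewrite (isoc i x y) // (isoc i x z) // => xy.
    have isoy : isolated G y by apply: twin_isolated isox; rewrite twin_sym.
    rewrite isoc //; first exact: twin_trans xy.
    exact: iso_out xy.
  case: (rep0 z) => [[isoz zg]|[e ze]].
    rewrite (cS i y z) (cS i x z) (isoc i z y) // (isoc i z x) // => + zy.
    have isoy : isolated G y by apply: twin_isolated isoz; rewrite twin_sym.
    rewrite (cS i x y) isoc //; first exact: twin_trans.
    exact: iso_out zy.
  rewrite xa yb (xa i z) (cS i (g a) y) yb (cS i (g b) z) ze (cS i (g a) z) ze.
  by rewrite (cS i _ (g a)) (cS i (g e)) (cS i _ (g a)); exact: trg.
- by move=> i; rewrite card_imset //; exact: imset_inj.
exists (fun h => g @: D h) => [h|h i j Rij]; first by rewrite card_imset.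
have pe i' : is_pairs (edited G M' i').
  by apply: is_pairs_symdiff => //; exact: edges_pairs.
apply/edges_outsideP => // x y xD yD; rewrite -/(c i) -/(c j).
have [[isox xg]|[a aD xa]] := rep x _ (leD h) xD; first by rewrite !isoc.
have [[isoy yg]|[b bD yb]] := rep y _ (leD h) yD; first by rewrite !(cS _ x) !isoc.
rewrite !xa !(cS _ (g a)) !yb !cg.
have /edges_outsideP := consD h i j Rij; apply=> //.
  by apply: is_pairs_symdiff => //; exact: edges_pairs.
by apply: is_pairs_symdiff => //; exact: edges_pairs.
Qed.

End Extend.
End Induced.

(** * Counting the vertices of a reduced yes-instance *)

Lemma card_bigcup_leq (I T : finType) (P : pred I) (F : I -> {set T}) m :
  (forall i, P i -> #|F i| <= m) -> #|\bigcup_(i | P i) F i| <= #|P| * m.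
Proof.
move=> leF; rewrite -sum_nat_const.
apply: (@leq_trans (\sum_(i | P i) #|F i|)); last by rewrite leq_sum.
elim/big_rec2: _ => [|i A n _]; first by rewrite cards0.
by move=> leA; apply: leq_trans (leq_card_setU _ _) _; rewrite leq_add2l.
Qed.

Section Counting.
Variables (V : finType) (l : nat) (G : 'I_l -> graph V) (k d t : nat).
Variables (M : 'I_l -> {set {set V}}) (S : {set V}).
Hypotheses (clM : clustering G M) (leM : bounded M k) (consM : totally_consistent G M d).
Hypothesis keptS : {in S, forall v, ~~ isolated G v}.
Hypothesis twinS : {in S, forall v, #|[set u in S | twin G u v]| <= t}.

(* Outside the deletion set and the edits, a vertex that is not isolated lies, in
   some layer, in an edited cluster containing a deleted vertex or a vertex edited
   in that layer; such a cluster meets the remaining vertices in twins. *)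
Lemma card_kept : #|S| <= l * ((d + k.*2) * t.+1).
Proof.
have [D leD consD] := consM.
pose c i := cadj (edited G M i).
have pM i : is_pairs (M i) by case: (clM i).
have trc i : transitive (c i) by have [_ /cliquesP[]] := clM i.
have cS i x y : c i x y = c i y x by exact: cadj_sym.
have cons i j x y : x \notin D -> y \notin D -> c i x y = c j x y.
  move=> xD yD; have /edges_outsideP := consD i j; apply=> //.
    by apply: is_pairs_symdiff => //; exact: edges_pairs.
  by apply: is_pairs_symdiff => //; exact: edges_pairs.
pose L i := D :|: cover (M i).
have cE i x y : x \notin L i -> c i x y = layer_adj G i x y.
  rewrite inE negb_or => /andP[_ xM]; rewrite /c /edited cadj_symdiff //.
  rewrite (negPf (_ : [set x; y] \notin M i)) ?addbF //.
  by apply: contra xM => xyM; apply/bigcupP; exists [set x; y]; rewrite ?set21.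
have cardL i : #|L i| <= d + k.*2.
  apply: leq_trans (leq_card_setU _ _) _; apply: leq_add => //.
  apply: leq_trans (leq_card_cover _) _.
  rewrite (eq_bigr (fun=> 2)) => [|e eM]; last first.
    by have /forall_inP/(_ e eM)/eqP := pM i.
  by rewrite sum_nat_const muln2 leq_double; exact: leM.
pose free v := [forall i, v \notin L i].
have freeP v i : free v -> v \notin L i by move/forallP.
have freeD v (i : 'I_l) : free v -> v \notin D 
  by move=> fv; have := freeP v i fv; rewrite inE negb_or => /andP[].
(* Two free vertices in a common edited cluster of layer [i] share one in every layer [j], and that
   cluster is the original closed neighbourhood of both. *)
have twin_free u v i : free u -> free v -> c i u v -> twin G u v.
  move=> fu fv uv; apply/twinP => j w.
  rewrite -!cE ?freeP //.
  have {}uv : c j u v by rewrite (cons _ i) // (@freeD _ i).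
  by apply/idP/idP; apply: trc => //; rewrite cS.
pose F i x := [set v in S | free v & c i x v].
have cardF i x : #|F i x| <= t.
  have [->|[v]] := set_0Vmem (F i x); first by rewrite cards0.
  rewrite inE => /and3P[vS fv xv].
  apply: leq_trans (twinS vS); apply: subset_leq_card; apply/subsetP => u.
  rewrite !inE => /and3P[-> fu xu] /=.
  by apply: (@twin_free _ _ i) => //; apply: (trc i x) => //; rewrite cS.
(* Each [x] in [L i] pays for itself and for the at most [t] free vertices in its edited cluster,
   hence the factor [t.+1]. *)
have coverS : S \subset \bigcup_i \bigcup_(x in L i) (x |: F i x).
  apply/subsetP => v vS; apply/bigcupP.
  have [fv|] := boolP (free v); last first.
    rewrite negb_forall => /existsP[i]; rewrite negbK => vL.
    by exists i => //; apply/bigcupP; exists v; rewrite // !inE eqxx.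
  have /forallPn[u] := keptS vS.
  rewrite negb_imply => /andP[/existsP[j uv] ntw].
  have cuv : c j v u by rewrite cE ?freeP // /layer_adj cadj_sym.
  have [fu|] := boolP (free u).
    by case/negP: ntw; apply: (@twin_free _ _ j); rewrite // cS.
  rewrite negb_forall => /existsP[i]; rewrite negbK => uL.
  have [uD|uD] := boolP (u \in D).
    exists j => //; apply/bigcupP; exists u; first by rewrite inE uD.
    by rewrite !inE vS fv cS cuv orbT.
  (* The neighbour [u] found in layer [j] may be edited only in another layer [i]. Since [u] and [v]
     both lie outside [D], their edited adjacency carries over from [j] to [i]. *)
  exists i => //; apply/bigcupP; exists u => //.
  by rewrite !inE vS fv cS (cons _ j) ?cuv ?orbT // (@freeD _ i).
apply: leq_trans (subset_leq_card coverS) _.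
rewrite -[X in _ <= X * _]card_ord; apply: card_bigcup_leq => i _.
apply: leq_trans (_ : #|L i| * t.+1 <= _); last by rewrite leq_mul2r cardL orbT.
apply: card_bigcup_leq => x _; apply: leq_trans (leq_card_setU _ _) _.
by rewrite cards1 add1n ltnS.
Qed.

End Counting.

(** * The least elements of a set of ordinals *)

Section FirstElements.
Variables (n t : nat) (A : {set 'I_n}).

Definition smaller (v : 'I_n) := [set u in A | u < v].

(** The largest selected element has fewer than [t] elements of [A] below it, and all other selected
    elements are among these. *)
Lemma card_first_leq : #|[set v in A | #|smaller v| < t]| <= t.
Proof.
set B := [set v in A | _]; have [->|[b bB]] := set_0Vmem B; first by rewrite cards0.
case: (@arg_maxnP _ b (mem B) val bB) => v vB maxv.
have /andP[vA] : (v \in A) && (#|smaller v| < t) by move: vB; rewrite /= /B inE.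
apply: leq_trans.
have -> : #|B| = #|B :\ v|.+1 by rewrite (cardsD1 v) (vB : v \in B).
rewrite ltnS; apply: subset_leq_card; apply/subsetP => u.
move=> /setD1P[uv uB]; have uA : u \in A by move: uB; rewrite inE => /andP[].
by rewrite inE uA ltn_neqAle (inj_eq val_inj) uv; exact: maxv.
Qed.

(** If fewer than [t] were selected, the least element of [A] that is not selected would have only
    selected elements below it, hence fewer than [t], and would be selected itself. *)
Lemma card_first_geq v : t <= #|smaller v| -> t <= #|[set u in A | #|smaller u| < t]|.
Proof.
set B := [set u in A | _] => lev; rewrite leqNgt; apply/negP => ltB.
have /subsetPn[b] : ~~ (smaller v \subset B).
  by apply: contraL ltB => /subset_leq_card ?; lia.
rewrite inE => /andP[bA _] bB.
have bP : (b \in A) && (b \notin B) by rewrite bA.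
case: (@arg_minnP _ b [pred u | (u \in A) && (u \notin B)] val bP) => u /andP[uA uB] minu.
case/negP: uB; rewrite inE uA; apply: leq_ltn_trans ltB.
apply: subset_leq_card; apply/subsetP => w; rewrite inE => /andP[wA wu].
apply: contraLR wu => wB; rewrite -leqNgt; apply: minu.
by rewrite /= wA.
Qed.

End FirstElements.

(** * The kernel *)

Section Kept.
Variables (n l : nat) (G : 'I_l -> graph 'I_n) (X : nat).

Definition twin_class (v : 'I_n) : {set 'I_n} := [set u | twin G u v].

(** Choosing the twins of least index lets each vertex be decided on its own, by counting its
    smaller twins. *)
Definition keep (v : 'I_n) : bool :=
  ~~ isolated G v && (#|smaller (twin_class v) v| < X.+2).

Definition kept_set : {set 'I_n} := [set v | keep v].

Definition kept_layer (i : 'I_l) : graph 'I_#|kept_set| :=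
  induced (@enum_val_inj _ (mem kept_set)) (G i).

Lemma kept_set_no_layer : l = 0 -> kept_set = set0.
Proof.
move=> l0; apply/setP => v; rewrite !inE /keep (_ : isolated _ _) //.
apply/forallP => u; apply/implyP => /existsP[i].
by case: {+}i => i' lt_i'; exfalso; rewrite l0 in lt_i'.
Qed.

Lemma twin_classE u v : twin G u v -> twin_class u = twin_class v.
Proof.
move=> uv; apply/setP=> w; rewrite !inE; apply/idP/idP => [wu|wv].
  exact: twin_trans uv.
by apply: twin_trans wv _; rewrite twin_sym.
Qed.

(** A dropped vertex that is not isolated has at least [X.+2] smaller twins, so [X.+2] vertices of
    its class are kept; they form the set [T] required for lifting. *)
Lemma solvable_kept H (R : H -> 'I_l -> 'I_l -> Prop) k d : k <= X -> d <= X ->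
  solvable kept_layer R k d <-> solvable G R k d.
Proof.
move=> kX dX; split; last exact: solvable_induced.
apply: solvable_extend => [v|a]; last first.
  by have := enum_valP a; rewrite inE => /andP[].
have codomE u : keep u -> u \in codom (@enum_val _ (mem kept_set)).
  move=> ku; have uS : u \in kept_set by rewrite inE.
  by rewrite -(enum_rankK_in uS uS); exact: codom_f.
have [isov|nisov] := boolP (isolated G v); first by left.
move=> /(contra (@codomE v)); rewrite /keep nisov /= -leqNgt => lev.
right; pose B := [set u in twin_class v | #|smaller (twin_class v) u| < X.+2].
have leB : X.+2 <= #|B| by exact: card_first_geq lev.
exists (@enum_val _ (mem kept_set) @^-1: B).
have leT : X.+2 <= #|@enum_val _ (mem kept_set) @^-1: B|.
  apply: leq_trans (leq_imset_card (@enum_val _ (mem kept_set)) _).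
  apply: leq_trans leB _; apply: subset_leq_card; apply/subsetP=> u uB.
  move: (uB); rewrite !inE => /andP[uv ltu].
  have /codomP[a ua] : u \in codom (@enum_val _ (mem kept_set)).
    apply: codomE; rewrite /keep (twin_classE uv) ltu andbT.
    by apply: contra nisov; apply: twin_isolated; rewrite twin_sym.
  by rewrite ua; apply: imset_f; rewrite inE -ua.
split; [exact: leq_trans leT|apply: leq_trans leT; exact: leqW|move=> a].
by rewrite !inE twin_sym => /andP[].
Qed.

Lemma card_kept_set M k d : clustering G M -> bounded M k ->
  totally_consistent G M d -> k + d = X -> #|kept_set| <= 8 * l * X ^ 2.
Proof.
move=> clM leM consM kdX.
apply: leq_trans (@card_kept _ _ _ _ _ X.+2 _ kept_set clM leM consM _ _) _.
- by move=> v; rewrite inE => /andP[].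
- move=> v _; apply: leq_trans (card_first_leq X.+2 (twin_class v)).
  apply: subset_leq_card; apply/subsetP=> u; rewrite !inE => /andP[/andP[_ ltu] uv].
  by rewrite uv -(twin_classE uv).
rewrite [8 * l]mulnC -mulnA leq_mul2l; apply/orP; right.
case: (posnP X) => [X0|X_gt0].
  have [-> ->] : d = 0 /\ k = 0 by lia.
  by [].
(* Origin of the constant 8: [d + k.*2 <= 2 * X], and [X + 3 <= 4 * X] for positive [X]. *)
apply: (@leq_trans ((2 * X) * (4 * X))); last by rewrite -mulnn; lia.
by apply: leq_mul; lia.
Qed.

End Kept.

(** * Trivial instances and the kernel map *)

Lemma set0_pairs (V : finType) : is_pairs (set0 : {set {set V}}).
Proof. by apply/forall_inP => e; rewrite inE. Qed.

Lemma solvable_empty (V : finType) l (G : 'I_l -> graph V) H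
    (R : H -> 'I_l -> 'I_l -> Prop) k d : #|V| = 0 -> solvable G R k d.
Proof.
move=> V0; have noV (x : V) : False.
  by have := max_card (pred1 x); rewrite V0 card1.
have p0 : is_pairs (set0 : {set {set V}}) := set0_pairs V.
exists (fun=> set0); split.
- move=> i; split => //; apply/cliquesP; split; last by move=> x; case: (noV x).
  by apply: is_pairs_symdiff => //; exact: edges_pairs.
- by move=> i; rewrite cards0.
exists (fun=> set0) => [h|h i j _]; first by rewrite cards0.
apply/edges_outsideP; first by apply: is_pairs_symdiff => //; exact: edges_pairs.
  by apply: is_pairs_symdiff => //; exact: edges_pairs.
by move=> x; case: (noV x).
Qed.

Lemma single_edge_pairs : is_pairs [set [set: 'I_2]].
Proof. by apply/forall_inP => e; rewrite inE => /eqP ->; rewrite cardsT card_ord. Qed.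

Definition trivial_yes : instance :=
  @Instance 0 0 0 0 (fun=> Graph (set0_pairs 'I_0)).

(** Both layers are cluster graphs, but they disagree on their only pair, and neither edits nor
    deletions are allowed. The layers are consecutive, so this is a no-instance of both problems. *)
Definition trivial_no : instance :=
  @Instance 2 2 0 0 (fun i => if i == ord0 then Graph single_edge_pairs
                              else Graph (set0_pairs 'I_2)).

Lemma trivial_no_inconsistent M :
  bounded M 0 -> ~ totally_consistent (@layer trivial_no) M 0.
Proof.
move=> leM [D leD consD].
have M0 i : M i = set0 by apply/eqP; rewrite -cards_eq0 -leqn0; exact: leM.
have D0 : D = set0 by apply/eqP; rewrite -cards_eq0 -leqn0.
have := consD ord0 ord_max; rewrite /edited !M0 D0 /=.
move/(congr1 (fun A : {set {set 'I_2}} => [set: 'I_2] \in A)).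
by rewrite !inE eqxx setC0 subxx.
Qed.

Section Kernel.
Variable X : instance -> nat.

Definition kept_vertices (I : instance) : {set 'I_(nvert I)} :=
  kept_set (@layer I) (X I).

Definition reduced (I : instance) : instance :=
  Instance (budget I) (distance I) (kept_layer (@layer I) (X I)).

(** The empty case is separated because the numbers [l], [k], [d] alone may exceed the size bound
    when [l] or [X] is 0. In the last case the kept set is nonempty, which makes both positive. *)
Definition kernel (I : instance) : instance :=
  if #|kept_vertices I| == 0 then trivial_yes
  else if 8 * nlayer I * X I ^ 2 < #|kept_vertices I| then trivial_no
  else reduced I.

(** [m l] is the factor by which the deletion bound grows when the deletion sets of a solution on
    [l] layers are merged into one. *)
Variables (m : nat -> nat) (Q : instance -> Prop) (H : nat -> Type).
Variable R : forall l, H l -> 'I_l -> 'I_l -> Prop.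
Hypothesis XE : forall I, X I = budget I + distance I * m (nlayer I).
Hypothesis m_gt0 : forall l, 0 < l -> 0 < m l.
Hypothesis QE : forall I,
  Q I <-> solvable (@layer I) (@R (nlayer I)) (budget I) (distance I).
Hypothesis R_total : forall V l (G : 'I_l -> graph V) M d, 0 < l ->
  consistent_along G (@R l) d M -> totally_consistent G M (d * m l).

(** Without layers [m] may vanish, so [X I] need not bound the distance; but then both instances
    have a solution trivially. *)
Lemma kernel_equiv I : Q I <-> Q (kernel I).
Proof.
have [l0|l_gt0] := posnP (nlayer I).
  have no_layer (i : 'I_(nlayer I)) : False by case: i => i; rewrite l0.
  have S0 : #|kept_vertices I| = 0 by rewrite /kept_vertices kept_set_no_layer ?cards0.
  rewrite /kernel S0 eqxx; split=> _; rewrite QE.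
    by apply: solvable_empty; rewrite card_ord.
  exists (fun=> set0); split=> [i|i|]; try by case: (no_layer i).
  by exists (fun=> set0) => [h|h i]; [rewrite cards0|case: (no_layer i)].
have kX : budget I <= X I by rewrite XE leq_addr.
have dX : distance I <= X I.
  by rewrite XE; apply: leq_trans (leq_addl _ _); rewrite leq_pmulr // m_gt0.
have QR : Q I <-> Q (reduced I) by rewrite !QE; symmetry; exact: solvable_kept.
rewrite /kernel; case: eqP => [S0|_].
  split=> [_|_]; first by rewrite QE; apply: solvable_empty; rewrite card_ord.
  by rewrite QR QE; apply: solvable_empty; rewrite card_ord.
case: ltnP => // ltS; split.
  rewrite QE => -[M [clM leM consM]]; exfalso; move: ltS; rewrite ltnNge => /negP; apply.
  by apply: card_kept_set clM leM (R_total l_gt0 consM) _; rewrite XE.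
rewrite QE => -[M [clM leM consM]]; case: (trivial_no_inconsistent leM).
exact: (R_total _ consM).
Qed.

End Kernel.

(** * Layout and size of encodings *)

Lemma nth_flatten_const (T : Type) (x0 : T) m (ss : seq (seq T)) i j :
  all (fun s => size s == m) ss -> i < size ss -> j < m ->
  nth x0 (flatten ss) (i * m + j) = nth x0 (nth [::] ss i) j.
Proof.
elim: ss i => // s ss IHs [|i] /= /andP[/eqP szs szss] lti ltj; rewrite nth_cat szs.
  by rewrite ltj.
by rewrite mulSn -addnA ltnNge leq_addr /= addKn; exact: IHs.
Qed.

Lemma nth_map_ord (T : Type) (x0 : T) n (f : 'I_n -> T) (i : 'I_n) :
  nth x0 [seq f j | j <- enum 'I_n] i = f i.
Proof. by rewrite (nth_map i) ?nth_ord_enum // size_enum_ord. Qed.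

Lemma adjacency_size I (i : 'I_(nlayer I)) : size (adjacency i) = nvert I * nvert I.
Proof. by rewrite size_allpairs size_enum_ord. Qed.

Lemma words_size I : size (words I) = 4 + nlayer I * (nvert I * nvert I).
Proof.
rewrite size_cat size_flatten /shape -map_comp; congr (_ + _).
rewrite (eq_map (g := fun=> nvert I * nvert I)); last by move=> i; exact: adjacency_size.
rewrite sumnE big_map big_enum /= sum_nat_const card_ord; congr (_ * _).
Qed.

Lemma nth_words I (i : 'I_(nlayer I)) (u v : 'I_(nvert I)) :
  nth 0 (words I) (4 + ((i * nvert I + u) * nvert I + v)) =
  ([set u; v] \in edges (layer i)).
Proof.
rewrite [words I]/= -[4 + _]/(((i * nvert I + u) * nvert I + v).+4) [LHS]/=.
rewrite mulnDl -mulnA -addnA nth_flatten_const.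
- rewrite nth_map_ord /adjacency nth_flatten_const; first by rewrite !nth_map_ord.
  + by rewrite all_map; apply/allP => u' _ /=; rewrite size_map size_enum_ord.
  + by rewrite size_map size_enum_ord.
  + by [].
- by rewrite all_map; apply/allP => j _ /=; rewrite adjacency_size.
- by rewrite size_map size_enum_ord.
have := ltn_ord u; have := ltn_ord v; nia.
Qed.

(** Every matrix entry takes one bit. For the four numbers the crude bound [x.+1] on the bit length
    is enough, since each is dominated by the kernel bound. *)
Lemma encoding_size_leq I : encoding_size I <=
  nvert I + nlayer I + budget I + distance I + 4 + nlayer I * (nvert I * nvert I).
Proof.
have bl x : bit_length x <= x.+1.
  rewrite /bit_length ltnS; case: x => [|x]; first by rewrite trunc_log0.
  exact: ltnW (leq_trans (ltn_expl _ (ltnSn 1)) (trunc_logP (ltnSn 1) (ltn0Sn x))).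
rewrite /encoding_size big_cat /= !big_cons big_nil.
have -> : \sum_(w <- flatten [seq adjacency i | i <- enum 'I_(nlayer I)]) bit_length w
    = nlayer I * (nvert I * nvert I).
  have := words_size I; rewrite size_cat => /addnI <-.
  rewrite big_seq (eq_bigr (fun=> 1)); last first.
    move=> w /flatten_mapP[i _ /allpairsP[[u v] [_ _ ->]]].
    by case: (_ \in _).
  by rewrite -big_seq sum1_size.
have := bl (nvert I); have := bl (nlayer I); have := bl (budget I).
have := bl (distance I); lia.
Qed.

(** * Reasoning about word RAM programs *)

Notation memory := Defs.mem.

(** Evaluation in unbounded arithmetic; [eval] agrees with it as long as nothing overflows. *)
Fixpoint den (r m : nat -> nat) (e : expr) : nat :=
  match e with
  | Const x => x
  | Reg i => r i
  | Fetch a => m (den r m a)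
  | Bin o a b => eval_binop o (den r m a) (den r m b)
  end.

(* N ^ degree h e bounds all values met when e is evaluated with registers and memory
   cells below N ^ h, where N >= 2. *)
Fixpoint degree (h : nat) (e : expr) : nat :=
  match e with
  | Const x => x
  | Reg _ => h
  | Fetch a => h + degree h a
  | Bin _ a b => (degree h a + degree h b).+1
  end.

Definition For (r : nat) (e : expr) (p : cmd) : cmd :=
  Seq (Assign r (Const 0))
      (While (Bin Lt (Reg r) e) (Seq p (Assign r (Bin Add (Reg r) (Const 1))))).

Definition Emit (base ptr : nat) (e : expr) : cmd :=
  Seq (Store (Bin Add (Reg base) (Reg ptr)) e)
      (Assign ptr (Bin Add (Reg ptr) (Const 1))).

Definition write (m : nat -> nat) (o : nat) (s : seq nat) : nat -> nat :=
  fun a => if o <= a < o + size s then nth 0 s (a - o) else m a.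

Lemma write_nil m o : write m o [::] =1 m.
Proof. by move=> a; rewrite /write /= addn0; case: (ltngtP o a). Qed.

Lemma write_rcons m o s x :
  upd (write m o s) (o + size s) x =1 write m o (rcons s x).
Proof.
move=> a; rewrite /upd /write size_rcons nth_rcons.
case: eqP => [->|neq]; first by rewrite addKn ltnn eqxx leq_addr addnS ltnSn.
case: (leqP o a) => //= le_oa; rewrite addnS ltnS.
case: (ltngtP a (o + size s)) => // lt_a.
by rewrite (_ : a - o < size s) //; lia.
Qed.

(** * Execution rules with time bounds *)

Section Runs.
(** Registers and memory cells stay below [N ^ h]; intermediate values of an expression are only
    required to fit into a word, below [N ^ c]. *)
Variables (N c h : nat).
Hypotheses (N_gt1 : 1 < N) (h_le_c : 2 * h + 2 <= c).
Let S := N ^ h.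

Definition small (r m : nat -> nat) : Prop :=
  (forall i, r i < S) /\ (forall a, m a < S).

(** The successor in the degree of an operation pays for the factor 2 of a sum and for the truth
    value 1; a product needs only the sum of the degrees, and a constant [x] is below [N ^ x]. *)
Lemma den_small r m e : small r m -> den r m e < N ^ degree h e.
Proof.
case=> rS mS; elim: e => [x|i|a IHa|o a IHa b IHb] //=.
- exact: ltn_expl.
- apply: leq_trans (mS _) _; rewrite leq_exp2l ?leq_addr //.
have N0 : 0 < N by apply: ltnW.
have leN i j x : i <= j -> x < N ^ i -> x < N ^ j.
  by move=> ij xi; apply: leq_trans xi _; rewrite leq_exp2l.
move: IHa IHb; set x := den r m a; set y := den r m b => ltx lty.
have ltx' := leN _ (degree h a + degree h b) _ (leq_addr _ _) ltx.
have lty' := leN _ (degree h a + degree h b) _ (leq_addl _ _) lty.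
have gt1 : 1 < N ^ (degree h a + degree h b).+1.
  by apply: leq_trans N_gt1 _; rewrite expnS leq_pmulr // expn_gt0 N0.
case: o => /=.
- by rewrite expnS; apply: leq_trans (_ : 2 * N ^ (degree h a + degree h b) <= _);
    [lia | rewrite leq_mul2r N_gt1 orbT].
- by apply: leq_ltn_trans (leq_subr _ _) _; apply: leN ltx'; exact: leqnSn.
- apply: (leN (degree h a + degree h b)); first exact: leqnSn.
  by rewrite expnD ltn_mul.
- by apply: leq_ltn_trans (leq_div _ _) _; apply: leN ltx'; exact: leqnSn.
- by case: eqP => _; [exact: gt1|exact: ltnW].
- by case: (x < y); [exact: gt1|exact: ltnW].
Qed.

Lemma eval_den s e : small (regs s) (memory s) -> degree h e <= c ->
  eval (N ^ c) s e = Some (den (regs s) (memory s) e).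
Proof.
move=> sm; have lt e' : degree h e' <= c -> den (regs s) (memory s) e' < N ^ c.
  by move=> ?; apply: leq_trans (den_small e' sm) _; rewrite leq_exp2l.
elim: e => [x|i|a IHa|o a IHa b IHb] le_c; move: (lt _ le_c) => /=; rewrite /word.
- by move->.
- by move->.
- by move=> lt'; rewrite IHa ?lt' // (leq_trans _ le_c) ?leq_addl.
move=> lt'; move: le_c => /= le_c.
by rewrite IHa ?IHb ?lt' //; lia.
Qed.

Lemma eq_den r r' m m' e : r =1 r' -> m =1 m' -> den r m e = den r' m' e.
Proof. by move=> rr mm; elim: e => //= [a ->|o a -> b ->]. Qed.

(* Registers beyond the list vs hold 0. *)
Variant runs (p : cmd) (vs : seq nat) (m : nat -> nat) (T : nat)
    (vs' : seq nat) (m' : nat -> nat) : Prop :=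
  Runs of forall s, regs s =1 nth 0 vs -> memory s =1 m -> small (nth 0 vs) m ->
    exists t s', [/\ exec (N ^ c) p s t s', t <= T, regs s' =1 nth 0 vs',
                     memory s' =1 m' & small (nth 0 vs') m'].

Lemma runs_weak p vs m T vs' m' T' : runs p vs m T vs' m' -> T <= T' ->
  runs p vs m T' vs' m'.
Proof.
case=> rp leT; constructor=> s rs ms sm; have [t [s' [ex leq_t *]]] := rp s rs ms sm.
by exists t, s'; split=> //; exact: leq_trans leT.
Qed.

Lemma runs_eq_mem p vs m T vs' m' n n' : runs p vs m T vs' m' ->
  m =1 n -> m' =1 n' -> runs p vs n T vs' n'.
Proof.
case=> rp mn mn'; constructor=> s rs ms [sr sm].
have [||t [s' [ex leq_t rs' ms' [sr' sm']]]] := rp s rs.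
- by move=> a; rewrite ms mn.
- by split=> // a; rewrite mn.
exists t, s'; split=> // [a|]; first by rewrite ms' mn'.
by split=> // a; rewrite -mn'.
Qed.

Lemma runs_skip vs m : runs Skip vs m 1 vs m.
Proof. by constructor=> s rs ms sm; exists 1, s; split=> //; constructor. Qed.

Lemma small_state s vs m : regs s =1 nth 0 vs -> memory s =1 m ->
  small (nth 0 vs) m -> small (regs s) (memory s).
Proof. by move=> rs ms [sr sm]; split=> i; rewrite ?rs ?ms. Qed.

Lemma eval_runs s vs m e : regs s =1 nth 0 vs -> memory s =1 m ->
  small (nth 0 vs) m -> degree h e <= c ->
  eval (N ^ c) s e = Some (den (nth 0 vs) m e).
Proof.
move=> rs ms sm le_c; rewrite eval_den ?(eq_den _ rs ms) //.
exact: small_state sm.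
Qed.

Lemma runs_assign r e vs m x : degree h e <= c -> den (nth 0 vs) m e = x -> x < S ->
  runs (Assign r e) vs m (expr_cost e).+1 (set_nth 0 vs r x) m.
Proof.
move=> le_c dx xS; constructor=> s rs ms sm.
exists (expr_cost e).+1, (State (upd (regs s) r x) (memory s)); split=> //.
- by apply: ExecAssign; rewrite (eval_runs rs ms) ?dx.
- by move=> i; rewrite nth_set_nth /= /upd rs.
case: sm => sr sm; split=> // i; rewrite nth_set_nth /=; by case: ifP.
Qed.

Lemma runs_seq p q vs m T1 vs1 m1 T2 vs2 m2 :
  runs p vs m T1 vs1 m1 -> runs q vs1 m1 T2 vs2 m2 ->
  runs (Seq p q) vs m (T1 + T2) vs2 m2.
Proof.
move=> [rp] [rq]; constructor=> s rs ms sm.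
have [t [s1 [ex1 le1 rs1 ms1 sm1]]] := rp s rs ms sm.
have [t' [s2 [ex2 le2 rs2 ms2 sm2]]] := rq s1 rs1 ms1 sm1.
by exists (t + t'), s2; split=> //; [exact: ExecSeq ex1 ex2 | exact: leq_add].
Qed.

Lemma runs_if e p q vs m T vs' m' : degree h e <= c ->
  runs (if den (nth 0 vs) m e != 0 then p else q) vs m T vs' m' ->
  runs (If e p q) vs m (expr_cost e + T).+1 vs' m'.
Proof.
move=> le_c [rpq]; constructor=> s rs ms sm.
have [t [s1 [ex1 le1 rs1 ms1 sm1]]] := rpq s rs ms sm.
exists (expr_cost e + t).+1, s1; split=> //; last by rewrite ltnS leq_add2l.
by apply: ExecIf ex1; exact: eval_runs rs ms sm le_c.
Qed.

Lemma runs_emit base ptr e vs m s x : degree h e <= c -> ptr != base ->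
  nth 0 vs ptr = size s -> den (nth 0 vs) (write m (nth 0 vs base) s) e = x ->
  x < S -> (size s).+1 < S ->
  runs (Emit base ptr e) vs (write m (nth 0 vs base) s) (expr_cost e + 8)
       (set_nth 0 vs ptr (size s).+1) (write m (nth 0 vs base) (rcons s x)).
Proof.
move=> le_c ptr_base ptrE dx xS sS; constructor=> st rs ms sm.
have ea := eval_runs (e := Bin Add (Reg base) (Reg ptr)) rs ms sm.
have ee := eval_runs (e := e) rs ms sm le_c.
pose st1 := State (regs st) (upd (memory st) (nth 0 vs base + size s) x).
have ms1 : memory st1 =1 write m (nth 0 vs base) (rcons s x).
  by move=> a; rewrite -write_rcons /upd /= /upd ms.
have sm1 : small (nth 0 vs) (write m (nth 0 vs base) (rcons s x)).
  by case: sm => sr sm; split=> // a; rewrite -write_rcons /upd; case: ifP.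
have le_c1 : degree h (Bin Add (Reg ptr) (Const 1)) <= c by rewrite /=; lia.
have d1 : den (nth 0 vs) (write m (nth 0 vs base) (rcons s x))
    (Bin Add (Reg ptr) (Const 1)) = (size s).+1 by rewrite /= ptrE addn1.
have [/(_ st1 rs ms1 sm1)[t [s' [ex le_t rs' ms' sm']]]] := runs_assign ptr le_c1 d1 sS.
exists ((expr_cost (Bin Add (Reg base) (Reg ptr)) + expr_cost e).+1 + t), s'; split=> //.
  apply: ExecSeq ex; apply: ExecStore; last by rewrite ee dx.
  by rewrite ea /= ?ptrE //; lia.
by move: le_t => /=; lia.
Qed.

(** [F i j] lists the registers with counter [i] after [j] rounds of the body. Two indices are
    needed because the body advances only [j], and the increment that closes the round only [i]. *)
Lemma runs_for r e p vs F m n T : degree h e + h + 1 <= c -> n < S ->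
  (forall i j, nth 0 (F i j) r = i) ->
  (forall i i' j, set_nth 0 (F i j) r i' = F i' j) ->
  set_nth 0 vs r 0 = F 0 0 ->
  (forall j, j <= n -> den (nth 0 (F j j)) (m j) e = n) ->
  (forall j, j < n -> runs p (F j j) (m j) T (F j j.+1) (m j.+1)) ->
  runs (For r e p) vs (m 0) (n * (T + (expr_cost e + 7)) + (expr_cost e + 6))
       (F n n) (m n).
Proof.
move=> le_c nS nthF setF vsF eF runp.
have le_c' : degree h (Bin Lt (Reg r) e) <= c by rewrite /=; lia.
have loop i j : i + j = n -> runs (While (Bin Lt (Reg r) e)
    (Seq p (Assign r (Bin Add (Reg r) (Const 1))))) (F j j) (m j)
    (i * (T + (expr_cost e + 7)) + (expr_cost e + 4)) (F n n) (m n).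
  elim: i j => [|i IHi] j ijn; constructor=> s rs ms sm; have jn : j <= n by lia.
    rewrite add0n in ijn; subst j.
    exists (expr_cost (Bin Lt (Reg r) e)).+1, s; split=> //; last by rewrite /=; lia.
    by apply: ExecWhileStop; rewrite (eval_runs rs ms) //= nthF eF // ltnn.
  have lt_jn : j < n by lia.
  have [t1 [s1 [ex1 le1 rs1 ms1 sm1]]] : exists t s', [/\ exec (N ^ c)
      (Seq p (Assign r (Bin Add (Reg r) (Const 1)))) s t s', t <= T + 4,
      regs s' =1 nth 0 (F j.+1 j.+1), memory s' =1 m j.+1
      & small (nth 0 (F j.+1 j.+1)) (m j.+1)].
    have le_c1 : degree h (Bin Add (Reg r) (Const 1)) <= c by rewrite /=; lia.
    have d1 : den (nth 0 (F j j.+1)) (m j.+1) (Bin Add (Reg r) (Const 1)) = j.+1.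
      by rewrite /= nthF addn1.
    have [|] := runs_seq (runp j lt_jn) (runs_assign r le_c1 d1 _).
      exact: leq_ltn_trans nS.
    by rewrite setF; apply.
  have [t2 [s2 [ex2 le2 rs2 ms2 sm2]]] :=
    let: Runs IH := IHi j.+1 (etrans (esym (addSnnS i j)) ijn) in IH s1 rs1 ms1 sm1.
  exists (expr_cost (Bin Lt (Reg r) e) + t1 + t2).+1, s2; split=> //.
    by apply: ExecWhileStep ex1 ex2; rewrite ?(eval_runs rs ms) //= nthF eF // lt_jn.
  by move: le1 le2 => /=; rewrite mulSn; lia.
apply: (@runs_weak _ _ _ (2 + (n * (T + (expr_cost e + 7)) + (expr_cost e + 4)))).
  apply: runs_seq (loop n 0 (addn0 n)); rewrite -vsF.
  by apply: (@runs_assign r (Const 0)) => //; rewrite expn_gt0 ltnW.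
lia.
Qed.
End Runs.

(** * The kernelization program *)

(* Memory: the input words, then (from address R_end) the list of kept vertices, then
   (from address R_out) the output. *)
Notation R_out := 0 (only parsing).
Notation R_n := 1 (only parsing).
Notation R_l := 2 (only parsing).
Notation R_X := 3 (only parsing).
Notation R_v := 4 (only parsing).
Notation R_u := 5 (only parsing).
Notation R_q := 6 (only parsing).
Notation R_diff := 7 (only parsing).
Notation R_adj := 8 (only parsing).
Notation R_bad := 9 (only parsing).
Notation R_before := 10 (only parsing).
Notation R_kept := 11 (only parsing).
Notation R_end := 12 (only parsing).
Notation R_ptr := 13 (only parsing).

Definition Mod (a b : expr) : expr := Bin Defs.Sub a (Bin Mul (Bin Div a b) b).

Definition entry (i u v : expr) : expr :=
  Fetch (Bin Add (Const 4)
    (Bin Add (Bin Mul (Bin Add (Bin Mul i (Reg R_n)) u) (Reg R_n)) v)).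

(** The diagonal of an adjacency matrix is 0, so this sum is again a bit. *)
Definition closed_entry (i u v : expr) : expr := Bin Add (entry i u v) (Bin Eq u v).

(* R_q runs over the numbers i * n + w encoding a layer i and a vertex w. *)
Definition pair_body : cmd :=
  let i := Bin Div (Reg R_q) (Reg R_n) in
  let w := Mod (Reg R_q) (Reg R_n) in
  Seq (Assign R_diff (Bin Lt (Const 0) (Bin Add (Reg R_diff)
         (Bin Eq (Bin Add (closed_entry i (Reg R_u) w) (closed_entry i (Reg R_v) w))
                 (Const 1)))))
      (Assign R_adj (Bin Lt (Const 0) (Bin Add (Reg R_adj)
         (closed_entry i (Reg R_u) (Reg R_v))))).

Definition pair_loop : cmd :=
  Seq (Assign R_diff (Const 0)) (Seq (Assign R_adj (Const 0))
    (For R_q (Bin Mul (Reg R_l) (Reg R_n)) pair_body)).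

(** [R_bad] detects a neighbour that is not a twin, the negation of being isolated; [R_before]
    counts the smaller twins. *)
Definition vertex_loop : cmd :=
  Seq (Assign R_bad (Const 0)) (Seq (Assign R_before (Const 0))
    (For R_u (Reg R_n) (Seq pair_loop
      (Seq (Assign R_bad (Bin Lt (Const 0) (Bin Add (Reg R_bad)
              (Bin Mul (Reg R_diff) (Reg R_adj)))))
           (Assign R_before (Bin Add (Reg R_before)
              (Bin Mul (Bin Eq (Reg R_diff) (Const 0)) (Bin Lt (Reg R_u) (Reg R_v))))))))).

Definition kept_loop : cmd :=
  For R_v (Reg R_n) (Seq vertex_loop
    (If (Bin Mul (Reg R_bad) (Bin Lt (Reg R_before) (Bin Add (Reg R_X) (Const 2))))
        (Emit R_end R_kept (Reg R_v)) Skip)).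

Definition emits (s : seq expr) : cmd := foldr (fun e => Seq (Emit R_out R_ptr e)) Skip s.

Definition kept_at (a : expr) : expr := Fetch (Bin Add (Reg R_end) a).

(** One flat loop over [q = (i * s + a) * s + b], with [s] the number of kept vertices, produces the
    entries in output order. *)
Definition matrix_loop : cmd :=
  let ia := Bin Div (Reg R_q) (Reg R_kept) in
  For R_q (Bin Mul (Reg R_l) (Bin Mul (Reg R_kept) (Reg R_kept)))
    (Emit R_out R_ptr (entry (Bin Div ia (Reg R_kept)) (kept_at (Mod ia (Reg R_kept)))
                             (kept_at (Mod (Reg R_q) (Reg R_kept))))).

(** The encoding of [trivial_no]. *)
Definition no_words : seq nat := [:: 2; 2; 0; 0; 0; 1; 1; 0; 0; 0; 0; 0].

(** With nothing kept, [Skip] already outputs [trivial_yes]: its four words are 0, and so is the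
    memory beyond the input. *)
Definition output : cmd :=
  If (Reg R_kept)
    (If (Bin Lt (Bin Mul (Bin Mul (Const 8) (Reg R_l)) (Bin Mul (Reg R_X) (Reg R_X)))
                (Reg R_kept))
       (emits [seq Const x | x <- no_words])
       (Seq (emits [:: Reg R_kept; Reg R_l; Fetch (Const 2); Fetch (Const 3)]) matrix_loop))
    Skip.

(* Without layers the number of vertices is set to 0, so that the running time
   does not depend on it. *)
Definition setup (b : bool) : cmd :=
  Seq (Assign R_l (Fetch (Const 1)))
  (Seq (Assign R_n (Bin Mul (Fetch (Const 0)) (Bin Lt (Const 0) (Reg R_l))))
  (Seq (Assign R_X (Bin Add (Fetch (Const 2))
          (Bin Mul (Fetch (Const 3)) (if b then Reg R_l else Const 1))))
  (Seq (Assign R_end (Bin Add (Const 4)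
          (Bin Mul (Reg R_l) (Bin Mul (Reg R_n) (Reg R_n)))))
       (Assign R_out (Bin Add (Reg R_end) (Reg R_n)))))).

Definition program (b : bool) : cmd := Seq (setup b) (Seq kept_loop output).

(** * Loop invariants of the program *)

Lemma has_iotaS (p : pred nat) j : has p (iota 0 j.+1) = has p (iota 0 j) || p j.
Proof. by rewrite -addn1 iotaD has_cat /= orbF. Qed.

Lemma count_iotaS (p : pred nat) j : count p (iota 0 j.+1) = count p (iota 0 j) + p j.
Proof. by rewrite -addn1 iotaD count_cat /= addn0. Qed.

Lemma filter_iotaS (p : pred nat) j : filter p (iota 0 j.+1) =
  if p j then rcons (filter p (iota 0 j)) j else filter p (iota 0 j).
Proof.
by rewrite -addn1 iotaD filter_cat /=; case: ifP => _; rewrite ?cats1 ?cats0.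
Qed.

Section Marking.
Variables (n l X : nat) (c : nat -> nat -> nat -> bool).

(** The last argument, here and below, is the number of rounds done, so these functions serve as
    invariants; the complete test has [j = l * n]. *)
Definition differ (u v j : nat) : bool :=
  has (fun q => c (q %/ n) u (q %% n) != c (q %/ n) v (q %% n)) (iota 0 j).

Definition meet (u v j : nat) : bool := has (fun q => c (q %/ n) u v) (iota 0 j).

Definition bad (v j : nat) : bool :=
  has (fun u => differ u v (l * n) && meet u v (l * n)) (iota 0 j).

Definition before (v j : nat) : nat :=
  count (fun u => ~~ differ u v (l * n) && (u < v)) (iota 0 j).

Definition marked (v : nat) : bool := bad v n && (before v n < X.+2).

Definition marked_below (j : nat) : seq nat := filter marked (iota 0 j).

(** Stored values are kept below [N ^ 5]; 300 is a generous bound on the degrees, at [h = 5], of all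
    expressions in the program. *)
Variables (N cc : nat).
Hypotheses (N_gt1 : 1 < N) (cc_ge : 300 <= cc).
Let S := N ^ 5.
Hypotheses (nS : n.+1 < S) (lnS : l * n < S).
Variables (m0 : nat -> nat).

Definition holds_matrix (m : nat -> nat) : Prop :=
  forall i u v, i < l -> u < n -> v < n ->
    m (4 + ((i * n + u) * n + v)) + (u == v) = c i u v.

Lemma S_gt1 : 1 < S.
Proof. by apply: leq_trans N_gt1 _; rewrite -{1}(expn1 N) leq_exp2l. Qed.

Lemma boolS (b : bool) : b < S.
Proof. by apply: leq_ltn_trans S_gt1; case: b. Qed.

Lemma leq_cc h : h <= 300 -> h <= cc.
Proof. by move=> le_h; exact: leq_trans cc_ge. Qed.

Lemma runs_reset r vs m : runs N cc 5 (Assign r (Const 0)) vs m 2 (set_nth 0 vs r 0) m.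
Proof. by apply: (runs_assign N_gt1) => //; [exact: leq_cc|exact: (boolS false)]. Qed.

Lemma runs_pair o x v u q d a b bf s K p m : v < n -> u < n -> holds_matrix m ->
  runs N cc 5 pair_loop [:: o; n; l; x; v; u; q; d; a; b; bf; s; K; p] m
    (l * n * 150 + 50)
    [:: o; n; l; x; v; u; l * n; nat_of_bool (differ u v (l * n));
        nat_of_bool (meet u v (l * n)); b; bf; s; K; p] m.
Proof.
move=> vn un hm; have le10 : 2 * 5 + 2 <= cc by exact: leq_cc.
pose F i j := [:: o; n; l; x; v; u; i; nat_of_bool (differ u v j);
  nat_of_bool (meet u v j); b; bf; s; K; p].
have body j : j < l * n -> runs N cc 5 pair_body (F j j) m 120 (F j j.+1) m.
  move=> lt_j; have n_gt0 : 0 < n by lia.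
  have dj : j %/ n < l by rewrite ltn_divLR.
  have mj : j %% n < n by rewrite ltn_mod.
  have jE : j - j %/ n * n = j %% n by rewrite {1}(divn_eq j n) addKn.
  eapply runs_weak; first eapply runs_seq.
  - apply: (runs_assign N_gt1 le10 R_diff (x := differ u v j.+1)); [exact: leq_cc| |exact: boolS].
    rewrite /= jE !hm //.
    (* Two bits differ exactly when their sum is 1, which is the test in the program. *)
    rewrite /differ has_iotaS; case: (has _ _) => //=.
    by case: (c _ u _); case: (c _ v _).
  - apply: (runs_assign N_gt1 le10 R_adj (x := meet u v j.+1)); [exact: leq_cc| |exact: boolS].
    rewrite /= hm // /meet has_iotaS.
    by case: (has _ _) => //=; case: (c _ u v).
  - by [].
rewrite /pair_loop; eapply runs_weak; first eapply runs_seq.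
- exact: runs_reset.
- eapply runs_seq; first exact: runs_reset.
  by apply: (runs_for N_gt1 le10 (F := F) (m := fun=> m) (n := l * n)) body => //; exact: leq_cc.
rewrite /=; lia.
Qed.

Lemma runs_vertex o x v u q d a b bf s K p m : v < n -> holds_matrix m ->
  runs N cc 5 vertex_loop
    [:: o; n; l; x; v; u; q; d; a; b; bf; s; K; p] m
    (n * (l * n * 150 + 100) + 50)
    [:: o; n; l; x; v; n; l * n; nat_of_bool (differ n.-1 v (l * n));
        nat_of_bool (meet n.-1 v (l * n)); nat_of_bool (bad v n); before v n; s; K; p] m.
Proof.
move=> vn hm; have le10 : 2 * 5 + 2 <= cc by exact: leq_cc.
(* Before the first round the scratch registers hold whatever they held on entry; after [j] rounds
   they hold the results for [j.-1]. *)
pose F i j := [:: o; n; l; x; v; i; if j == 0 then q else l * n;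
  if j == 0 then d else nat_of_bool (differ j.-1 v (l * n));
  if j == 0 then a else nat_of_bool (meet j.-1 v (l * n));
  nat_of_bool (bad v j); before v j; s; K; p].
have FE : F n n = [:: o; n; l; x; v; n; l * n; nat_of_bool (differ n.-1 v (l * n));
    nat_of_bool (meet n.-1 v (l * n)); nat_of_bool (bad v n); before v n; s; K; p].
  by rewrite /F gtn_eqF // (leq_ltn_trans _ vn).
have le_before j : before v j <= j.
  by apply: leq_trans (count_size _ _) _; rewrite size_iota.
rewrite -FE /vertex_loop; eapply runs_weak; first eapply runs_seq.
- exact: runs_reset.
- eapply runs_seq; first exact: runs_reset.
  apply: (runs_for N_gt1 le10 (F := F) (m := fun=> m) (n := n)
           (T := l * n * 150 + 80)) => //; first exact: leq_cc.
    exact: ltnW.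
  move=> j lt_j; eapply runs_weak; first eapply runs_seq.
  + exact: runs_pair.
  + eapply runs_seq.
      apply: (runs_assign N_gt1 le10 R_bad (x := bad v j.+1));
        [exact: leq_cc| |exact: boolS].
      rewrite /= /bad has_iotaS.
      by case: (has _ _) => //=; case: (differ _ _ _) => //=; case: (meet _ _ _).
    apply: (runs_assign N_gt1 le10 R_before (x := before v j.+1)); first exact: leq_cc.
      by rewrite /= /before count_iotaS; case: (differ _ _ _) => //=; case: (j < v).
    by apply: leq_ltn_trans (le_before _) _; apply: leq_ltn_trans nS; exact: leqW.
  + rewrite /=; lia.
rewrite /=; lia.
Qed.

Lemma index_lt i u v : i < l -> u < n -> v < n -> (i * n + u) * n + v < l * (n * n).
Proof.
move=> il un vn; apply: (@leq_trans ((i * n + u).+1 * n)); first by lia.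
rewrite mulnA leq_mul2r; apply/orP; right.
by apply: leq_trans (_ : i.+1 * n <= _); [lia|rewrite leq_mul2r il orbT].
Qed.

Lemma runs_kept o K p : K = 4 + l * (n * n) -> holds_matrix m0 ->
  exists v u q d a b bf, runs N cc 5 kept_loop
    [:: o; n; l; X; 0; 0; 0; 0; 0; 0; 0; 0; K; p] m0
    (n * (n * (l * n * 150 + 100) + 150) + 50)
    [:: o; n; l; X; v; u; q; d; a; b; bf; size (marked_below n); K; p]
    (write m0 K (marked_below n)).
Proof.
move=> KE hm0; have le10 : 2 * 5 + 2 <= cc by exact: leq_cc.
(* The kept list is written from [K] on, just past the input, and leaves the matrices intact. *)
have hm j : holds_matrix (write m0 K (marked_below j)).
  move=> i u v il un vn; rewrite /write leqNgt (_ : _ < K) /=; first exact: hm0.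
  by rewrite KE ltn_add2l index_lt.
have size_marked j : size (marked_below j) <= j.
  by rewrite size_filter (leq_trans (count_size _ _)) ?size_iota.
pose F i j := [:: o; n; l; X; i; if j == 0 then 0 else n;
  if j == 0 then 0 else l * n;
  if j == 0 then 0 else nat_of_bool (differ n.-1 j.-1 (l * n));
  if j == 0 then 0 else nat_of_bool (meet n.-1 j.-1 (l * n));
  if j == 0 then 0 else nat_of_bool (bad j.-1 n);
  if j == 0 then 0 else before j.-1 n; size (marked_below j); K; p].
suff rk : runs N cc 5 kept_loop (set_nth 0 (F 0 0) R_v 0) (write m0 K (marked_below 0))
    (n * (n * (l * n * 150 + 100) + 150) + 50) (F n n) (write m0 K (marked_below n)).
  do 7 eexists; apply: runs_eq_mem rk _ _ => //; exact: write_nil.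
apply: runs_weak.
  apply: (runs_for N_gt1 le10 (F := F) (m := fun j => write m0 K (marked_below j)) (n := n)
    (T := n * (l * n * 150 + 100) + 120)) => //; [exact: leq_cc|exact: ltnW|].
  move=> j lt_j; apply: runs_weak; first apply: runs_seq.
  - exact: runs_vertex.
  - apply: (runs_if N_gt1 le10 (T := 10)); first exact: leq_cc.
    pose vs := [:: o; n; l; X; j; n; l * n; nat_of_bool (differ n.-1 j (l * n));
      nat_of_bool (meet n.-1 j (l * n)); nat_of_bool (bad j n); before j n;
      size (marked_below j); K; p].
    have -> : den (nth 0 vs) (write m0 K (marked_below j))
        (Bin Mul (Reg R_bad) (Bin Lt (Reg R_before) (Bin Add (Reg R_X) (Const 2)))) =
        marked j.
      by rewrite /= addn2 mulnb.
    have := filter_iotaS marked j; rewrite -/(marked_below j) -/(marked_below j.+1).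
    case: (marked j) => [eqm|eqm] /=.
      rewrite /F /= eqm size_rcons.
      have jS : j < S by apply: leq_ltn_trans nS; apply: leqW; exact: ltnW.
      have sS : (size (marked_below j)).+1 < S.
        by apply: leq_ltn_trans nS; rewrite ltnS; exact: leq_trans (size_marked j) (ltnW _).
      apply: runs_weak.
        by apply: (runs_emit N_gt1 le10 (base := R_end) (ptr := R_kept) (e := Reg R_v)
          (vs := vs) _ _ _ _ jS sS); rewrite //; exact: leq_cc.
      by [].
    by rewrite /F /= eqm; apply: runs_weak; [exact: runs_skip|].
  - rewrite /=; lia.
rewrite /=; lia.
Qed.

Lemma write_below m o s a : a < o -> write m o s a = m a.
Proof. by move=> lt_ao; rewrite /write leqNgt lt_ao. Qed.

Lemma write_at m o s a : a < size s -> write m o s (o + a) = nth 0 s a.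
Proof. by move=> lt_as; rewrite /write leq_addr ltn_add2l lt_as addKn. Qed.

(** Each expression must keep its value whatever has been emitted so far, hence the quantification
    over [p] and [t]. *)
Lemma runs_emits (V : nat -> seq nat) o m es xs s :
  (forall p, nth 0 (V p) R_ptr = p) -> (forall p, nth 0 (V p) R_out = o) ->
  (forall p p', set_nth 0 (V p) R_ptr p' = V p') ->
  size es = size xs -> (size s + size xs).+1 < S ->
  (forall i, i < size xs -> let e := nth (Const 0) es i in let x := nth 0 xs i in
     [/\ degree 5 e <= 300, expr_cost e <= 2, x < S
       & forall p t, den (nth 0 (V p)) (write m o t) e = x]) ->
  runs N cc 5 (emits es) (V (size s)) (write m o s) (size xs * 10 + 1)
    (V (size s + size xs)) (write m o (s ++ xs)).
Proof.
move=> Vp Vo setV; have le10 : 2 * 5 + 2 <= cc by exact: leq_cc.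
elim: es xs s => [|e es IHes] [|x xs] s //= szs ltS esP.
  by rewrite addn0 cats0; exact: runs_skip.
have [/= dege coste xS dene] := esP 0 isT.
apply: runs_weak; first apply: runs_seq.
- rewrite -(Vo (size s)).
  apply: (runs_emit N_gt1 le10 (ptr := R_ptr) (base := R_out) (e := e)
    (s := s) (x := x)) => //; [exact: leq_cc|by rewrite Vo dene|].
  by apply: leq_ltn_trans ltS; lia.
- rewrite setV Vo -addSnnS -cat_rcons -(size_rcons s x).
  apply: IHes; [by case: szs|by rewrite size_rcons addSnnS|].
  by move=> i lt_i; exact: (esP i.+1).
- by lia.
Qed.

Section Output.
Variables (K o : nat) (ks : seq nat) (k d : nat).
Hypotheses (KE : K = 4 + l * (n * n)) (oE : o = K + n).
Hypotheses (hm0 : holds_matrix m0) (size_ks : size ks <= n) (ksn : all (gtn n) ks).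
Hypotheses (m2 : m0 2 = k) (m3 : m0 3 = d) (kS : k < S) (dS : d < S).
Hypotheses (lS : l < S) (bigS : 20 + l * (n * n) < S) .
Hypothesis m_end : forall a, K <= a -> m0 a = 0.

Definition output_words : seq nat :=
  if size ks == 0 then [:: 0; 0; 0; 0]
  else if 8 * l * (X * X) < size ks then no_words
  else [:: size ks; l; k; d] ++
    [seq m0 (4 + ((q %/ size ks %/ size ks * n + nth 0 ks (q %/ size ks %% size ks)) * n
                  + nth 0 ks (q %% size ks))) | q <- iota 0 (l * (size ks * size ks))].

Lemma runs_output v u q dd a b bf : exists vs' m',
  [/\ runs N cc 5 output [:: o; n; l; X; v; u; q; dd; a; b; bf; size ks; K; 0]
        (write m0 K ks) (l * (n * n) * 100 + 300) vs' m',
      nth 0 vs' R_out = o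
    & forall i, i < size output_words -> m' (o + i) = nth 0 output_words i].
Proof.
have le10 : 2 * 5 + 2 <= cc by exact: leq_cc.
pose V p := [:: o; n; l; X; v; u; q; dd; a; b; bf; size ks; K; p].
rewrite -/(V 0) /output_words; case: eqP => [ks0|/eqP ks0].
  exists (V 0), (write m0 K ks); split=> //.
    apply: runs_weak; first apply: (runs_if N_gt1 le10); first exact: leq_cc.
      by rewrite /= ks0; exact: runs_skip.
    by rewrite /=; lia.
  move=> i lt_i; rewrite (size0nil ks0) write_nil m_end; last by lia.
  by move: i lt_i; do 4 case=> //.
have SN : 20 < S by lia.
case: ifP => [lt_ks|/negbT nlt_ks].
  exists (V 12), (write (write m0 K ks) o no_words); split=> //.
    apply: runs_weak; first apply: (runs_if N_gt1 le10); first exact: leq_cc.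
      rewrite /= ks0.
      apply: (runs_if N_gt1 le10); first exact: leq_cc.
      rewrite /= lt_ks /=.
      apply: (runs_eq_mem (m := write (write m0 K ks) o [::])); [|exact: write_nil|by []].
      apply: (@runs_emits V o (write m0 K ks) [seq Const x | x <- no_words] no_words [::])
        => //=; first by lia.
      by do 12 (case=> [_|]; first by split=> //=; exact: leq_ltn_trans SN).
    by rewrite /=; lia.
  by move=> i lt_i; rewrite write_at.
set W := _ ++ _.
have sizeW : size W = 4 + l * (size ks * size ks) by rewrite size_cat size_map size_iota.
have le_sq : l * (size ks * size ks) <= l * (n * n) by rewrite leq_mul2l leq_mul ?orbT.
have nth_ks i : i < size ks -> nth 0 ks i < n by move=> ?; exact: (all_nthP 0 ksn).
pose F i j := [:: o; n; l; X; v; u; i; dd; a; b; bf; size ks; K; 4 + j].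
pose m j := write (write m0 K ks) o (take (4 + j) W).
exists (F (l * (size ks * size ks)) (l * (size ks * size ks))),
  (m (l * (size ks * size ks))); split=> //; last first.
  by move=> i lt_i; rewrite /m -sizeW take_size write_at.
apply: runs_weak; first apply: (runs_if N_gt1 le10); first exact: leq_cc.
  rewrite /= ks0.
  apply: (runs_if N_gt1 le10); first exact: leq_cc.
  rewrite /= (negPf nlt_ks) /=.
  apply: runs_seq.
    apply: (runs_eq_mem (m := write (write m0 K ks) o [::])
        (m' := write (write m0 K ks) o ([::] ++ [:: size ks; l; k; d]))
        (n' := m 0)); first 1 last.
    - exact: write_nil.
    - by move=> a'; rewrite /m /W addn0 /= take0.
    apply: (@runs_emits V o (write m0 K ks)
      [:: Reg R_kept; Reg R_l; Fetch (Const 2); Fetch (Const 3)]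
      [:: size ks; l; k; d] [::]) => //=; first by lia.
    case=> [_|[_|[_|[_|//]]]]; split=> //=.
    + by lia.
    + by move=> p t; rewrite !write_below //; lia.
    + by move=> p t; rewrite !write_below //; lia.
  apply: (@runs_for _ _ _ N_gt1 le10 _ _ _ (V 4) F m (l * (size ks * size ks)) 70) => //.
  - exact: leq_cc.
  - by lia.
  move=> j lt_j.
  have ks_gt0 : 0 < size ks by rewrite lt0n.
  have dj : j %/ size ks %/ size ks < l by rewrite !ltn_divLR // -mulnA.
  have sub_mod x y : x - x %/ y * y = x %% y by rewrite {1}(divn_eq x y) addKn.
  have nthW : nth 0 W (4 + j) = m0 (4 + ((j %/ size ks %/ size ks * n
      + nth 0 ks (j %/ size ks %% size ks)) * n + nth 0 ks (j %% size ks))).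
    by rewrite nth_cat /= addKn (nth_map 0) ?size_iota // nth_iota.
  have idx := index_lt dj (nth_ks _ (ltn_pmod (j %/ size ks) ks_gt0))
    (nth_ks _ (ltn_pmod j ks_gt0)).
  have takeW : rcons (take (4 + j) W) (nth 0 W (4 + j)) = take (4 + j.+1) W.
    by rewrite addnS -take_nth // sizeW ltn_add2l.
  have size_take : size (take (4 + j) W) = 4 + j.
    by rewrite size_takel // sizeW leq_add2l ltnW.
  apply: runs_weak.
    rewrite /m -takeW -{1 2}[o]/(nth 0 (F j j) R_out).
    rewrite (_ : F j j.+1 = set_nth 0 (F j j) R_ptr (size (take (4 + j) W)).+1); last first.
      by rewrite size_take.
    apply: (runs_emit N_gt1 le10 (ptr := R_ptr) (base := R_out)) => //.
    - exact: leq_cc.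
    - rewrite nthW /= !sub_mod.
      (* The kept list has at most [n] entries, so it ends before the output, which starts at
         [K + n]. *)
      have mks i : i < size ks -> write (write m0 K ks) o (take (4 + j) W) (K + i) = nth 0 ks i.
        by move=> lt_i; rewrite write_below ?write_at // oE ltn_add2l (leq_trans lt_i).
      by rewrite !mks ?ltn_mod // !write_below // ?oE KE; have := idx; lia.
    - rewrite nthW; apply: leq_ltn_trans S_gt1.
      have matE := hm0 dj (nth_ks _ (ltn_pmod (j %/ size ks) ks_gt0))
        (nth_ks _ (ltn_pmod j ks_gt0)).
      apply: (@leq_trans (c (j %/ size ks %/ size ks) (nth 0 ks (j %/ size ks %% size ks))
        (nth 0 ks (j %% size ks)))); last by case: (c _ _ _).
      by rewrite -matE leq_addr.
    - by rewrite size_take; lia.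
  by [].
by rewrite /=; lia.
Qed.
End Output.
End Marking.

(** * Correctness of the program *)

Lemma enum_setE (T : finType) (A : {set T}) : enum A = [seq x <- enum T | x \in A].
Proof. by rewrite enumT. Qed.

(* b distinguishes TCE from MLCE. *)
Definition multiplier (b : bool) (l : nat) : nat := if b then l else 1.

Definition parameter (b : bool) (I : instance) : nat :=
  budget I + distance I * multiplier b (nlayer I).

Section Correctness.
Variables (b : bool) (I : instance).
Let l := nlayer I.
Let n := nvert I * (0 < l).
Let X := parameter b I.
Let m0 := nth 0 (words I).
Let N := nvert I + l + budget I + distance I + 2.
Let S := N ^ 5.
Let K := 4 + l * (n * n).

Definition word_adj (i u v : nat) : bool :=
  m0 (4 + ((i * n + u) * n + v)) + (u == v) != 0.

Lemma layers_n (i : 'I_l) : n = nvert I.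
Proof. by rewrite /n (leq_trans _ (ltn_ord i)) // muln1. Qed.

Lemma word_adjE (i : 'I_l) (u v : 'I_(nvert I)) :
  word_adj i u v = layer_adj (@layer I) i u v :> bool /\
  m0 (4 + ((i * n + u) * n + v)) + (val u == val v) = word_adj i u v.
Proof.
rewrite /word_adj (layers_n i) /m0 nth_words /layer_adj /cadj.
have -> : (val u == val v) = (u == v) by [].
case: (eqVneq u v) => [->|_]; last by case: (_ \in _).
by rewrite (negPf (is_pairs_loop v (edges_pairs (layer i)))).
Qed.

Lemma word_matrix : holds_matrix n l word_adj m0.
Proof.
move=> i u v il un vn; have iE := layers_n (Ordinal il).
move: un vn; rewrite {1 2}iE => un vn.
by have [_] := word_adjE (Ordinal il) (Ordinal un) (Ordinal vn).
Qed.

(** The largest quantities are addresses, of order [N ^ 3]. The remaining factor [N ^ 2] is at least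
    4 and absorbs the lower terms; the constant 20 fits even for [N = 2], where [S = 32]. *)
Lemma S_bounds : [/\ n.+1 < S, l * n < S, 20 + l * (n * n) + n < S, l < S & X < S].
Proof.
have nN : n <= nvert I by rewrite /n; case: (0 < l); lia.
have le1 : n.+1 < N by rewrite /N; lia.
have le2 : l < N by rewrite /N; lia.
have N2 : 2 <= N by rewrite /N; lia.
have SE : S = N * N * N * (N * N) by rewrite /S !expnS expn0; lia.
have N4 : 4 <= N * N by exact: (leq_mul N2 N2).
have N3 : 8 <= N * N * N by exact: (leq_mul N4 N2).
have S4 : N * N * N * 4 <= S by rewrite SE leq_mul2l N4 orbT.
have lnn : l * (n * n) <= N * N * N.
  by rewrite -mulnA leq_mul ?leq_mul //; lia.
have ln : l * n <= N * N by rewrite leq_mul //; lia.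
have NN : N * N <= N * N * N by rewrite leq_pmulr //; lia.
have N1 : N <= N * N by rewrite leq_pmulr //; lia.
have lX : X <= N * N + N.
  rewrite /X /parameter addnC; apply: leq_add; last by rewrite /N; lia.
  by rewrite /multiplier; case: b; rewrite leq_mul // -/l /N; lia.
split; try lia.
case: (posnP n) => [->|n_gt0]; first by lia.
have N3' : 3 <= N by rewrite /N; lia.
have : 27 <= N * N * N by exact: (leq_mul (leq_mul N3' N3') N3').
lia.
Qed.

Lemma words_small a : m0 a < S.
Proof.
have NS : N <= S by rewrite -{1}(expn1 N) leq_exp2l // /N; lia.
apply: leq_trans NS; rewrite /m0.
case: (ltnP a (size (words I))) => [lt_a|?]; last by rewrite nth_default // /N; lia.
have : all (gtn N) (words I).
  rewrite all_cat /=; apply/andP; split; first by rewrite /N /l; apply/and5P; split; lia.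
  apply/allP => w /flatten_mapP[i _ /allpairsP[[u v] [_ _ ->]]] /=.
  by rewrite /N; case: (_ \in _); lia.
by move/(all_nthP 0)/(_ _ lt_a).
Qed.

Lemma words_past a : K <= a -> m0 a = 0.
Proof.
move=> Ka; apply: nth_default; apply: leq_trans Ka; rewrite words_size /K -/l /n.
by case: (posnP l) => [->|l_gt0]; rewrite // muln1.
Qed.

Lemma runs_setup : runs N 300 5 (setup b) (nseq 14 0) m0 60
  [:: K + n; n; l; X; 0; 0; 0; 0; 0; 0; 0; 0; K; 0] m0.
Proof.
have [nS lnS lnnS lS XS] := S_bounds.
have N_gt1 : 1 < N by rewrite /N; lia.
have le10 : 2 * 5 + 2 <= 300 by [].
apply: runs_weak; first apply: runs_seq.
- by apply: (runs_assign N_gt1 le10 R_l (x := l)).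
- apply: runs_seq.
    apply: (runs_assign N_gt1 le10 R_n (x := n)) => //.
    exact: ltnW.
  apply: runs_seq.
    apply: (runs_assign N_gt1 le10 R_X (x := X)) => //.
      by case: b.
    by rewrite /X /parameter /multiplier; case: b.
  apply: runs_seq.
    apply: (runs_assign N_gt1 le10 R_end (x := K)) => //.
    by rewrite -/S; lia.
  apply: (runs_assign N_gt1 le10 R_out (x := K + n)) => //.
  by rewrite -/S /K; lia.
by case: b.
Qed.

Let ks := marked_below n l X word_adj n.

Lemma differE (u v : 'I_(nvert I)) : 0 < l ->
  differ n word_adj u v (l * n) = ~~ twin (@layer I) u v.
Proof.
move=> l_gt0; have nE := layers_n (Ordinal l_gt0).
apply/hasP/idP => [[q]|].
  rewrite mem_iota /= add0n => lt_q ne.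
  have n_gt0 : 0 < n by lia.
  have ltd : q %/ n < l by rewrite ltn_divLR.
  have ltm : q %% n < nvert I by rewrite -nE ltn_mod.
  apply/negP => /twinP tw; case/negP: ne; apply/eqP.
  have [e1 _] := word_adjE (Ordinal ltd) u (Ordinal ltm).
  have [e2 _] := word_adjE (Ordinal ltd) v (Ordinal ltm).
  by rewrite /= in e1 e2; rewrite e1 e2 tw.
move/forallPn => [i /forallPn[w ne]].
have wn : w < n by rewrite nE.
exists (i * n + w).
  rewrite mem_iota /= add0n; apply: leq_trans (_ : i.+1 * n <= _).
    by rewrite mulSn addnC ltn_add2r.
  by rewrite leq_mul2r ltn_ord orbT.
rewrite divnMDl ?(leq_ltn_trans _ wn) // divn_small // addn0 modnMDl modn_small //.
have [-> _] := word_adjE i u w; have [-> _] := word_adjE i v w.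
exact: ne.
Qed.

Lemma meetE (u v : 'I_(nvert I)) : 0 < l ->
  meet n word_adj u v (l * n) = [exists i, layer_adj (@layer I) i u v].
Proof.
move=> l_gt0; have nE := layers_n (Ordinal l_gt0).
apply/hasP/existsP => [[q]|[i adj]].
  rewrite mem_iota /= add0n => lt_q.
  have n_gt0 : 0 < n by lia.
  have ltd : q %/ n < l by rewrite ltn_divLR.
  by have [e1 _] := word_adjE (Ordinal ltd) u v; rewrite e1; exists (Ordinal ltd).
have n_gt0 : 0 < n by rewrite nE (leq_ltn_trans _ (ltn_ord u)).
exists (i * n); last by rewrite mulnK //; have [-> _] := word_adjE i u v.
by rewrite mem_iota /= add0n ltn_pmul2r.
Qed.

Lemma iota_n : 0 < l -> iota 0 n = [seq val u | u <- enum 'I_(nvert I)].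
Proof. by move=> l_gt0; rewrite val_enum_ord (layers_n (Ordinal l_gt0)). Qed.

Lemma markedE (v : 'I_(nvert I)) : 0 < l -> marked n l X word_adj v = keep (@layer I) X v.
Proof.
move=> l_gt0; congr (_ && (_ < _)).
  rewrite /bad iota_n // has_map; apply/hasP/idP => [[u _] /=|].
    rewrite differE // meetE // => /andP[ntw adj].
    by apply/forallPn; exists u; rewrite adj.
  move/forallPn => [u]; rewrite negb_imply => /andP[adj ntw].
  by exists u; rewrite ?mem_enum //= differE // meetE // ntw.
rewrite /before iota_n // count_map -size_filter /smaller cardE.
rewrite enum_setE.
by congr size; apply: eq_filter => u /=; rewrite !inE differE // negbK.
Qed.

Lemma kept_wordsE : 0 < l -> ks = [seq val v | v <- enum (kept_vertices (parameter b) I)].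
Proof.
move=> l_gt0; rewrite /ks /marked_below iota_n // filter_map.
rewrite enum_setE.
by congr map; apply: eq_filter => u /=; rewrite !inE markedE.
Qed.


Let kept_n := #|kept_vertices (parameter b) I|.

Lemma size_ks : 0 < l -> size ks = kept_n.
Proof. by move=> l_gt0; rewrite kept_wordsE // size_map -cardE. Qed.

Lemma nth_ks (a : 'I_kept_n) : 0 < l -> nth 0 ks a = enum_val a.
Proof.
move=> l_gt0; rewrite kept_wordsE // (enum_val_nth (enum_val a)) (nth_map (enum_val a)) //.
by rewrite -cardE.
Qed.

Lemma reduced_words : 0 < l -> words (reduced (parameter b) I) =
  [:: size ks; l; budget I; distance I] ++
    [seq m0 (4 + ((q %/ size ks %/ size ks * n + nth 0 ks (q %/ size ks %% size ks)) * n
                  + nth 0 ks (q %% size ks))) | q <- iota 0 (l * (size ks * size ks))].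
Proof.
move=> l_gt0; have nE := layers_n (Ordinal l_gt0).
apply: (@eq_from_nth _ 0).
  by rewrite words_size size_cat size_map size_iota size_ks.
move=> q; rewrite words_size /= -/l -/kept_n => lt_q.
case: (ltnP q 4) => [lt_q4|le_4q].
  by rewrite size_ks //; move: q lt_q lt_q4; do 4 case=> //.
have [p qE] : exists p, q = 4 + p by exists (q - 4); rewrite subnKC.
rewrite {q le_4q}qE in lt_q *; rewrite ltn_add2l in lt_q.
rewrite -[RHS]/(nth 0 (map _ _) p) size_ks // (nth_map 0) ?size_iota // nth_iota // add0n.
have kept_gt0 : 0 < kept_n by lia.
have lti : p %/ kept_n %/ kept_n < l by rewrite !ltn_divLR // -mulnA.
pose i : 'I_l := Ordinal lti.
pose u : 'I_kept_n := Ordinal (ltn_pmod (p %/ kept_n) kept_gt0).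
pose v : 'I_kept_n := Ordinal (ltn_pmod p kept_gt0).
rewrite {1}(divn_eq p kept_n) {1}(divn_eq (p %/ kept_n) kept_n).
rewrite (nth_words (I := reduced (parameter b) I) i u v).
rewrite -[p %/ kept_n %% kept_n]/(val u) -[p %% kept_n]/(val v) -[p %/ _ %/ _]/(val i).
by rewrite !nth_ks // nE /m0 nth_words /= mem_preim_edges.
Qed.

Lemma trivial_no_words : words trivial_no = no_words.
Proof.
have pairT (u v : 'I_2) : ([set u; v] == [set: 'I_2]) = (u != v).
  rewrite eqEcard subsetT cardsT card_ord cards2.
  by case: (u != v).
rewrite /words /adjacency /= !enum_ordSl (size0nil (size_enum_ord 0)) /=.
by rewrite !inE !pairT.
Qed.

Lemma kernel_words :
  words (kernel (parameter b) I) = output_words n l X m0 ks (budget I) (distance I).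
Proof.
rewrite /kernel /output_words.
have yes_words : words trivial_yes = [:: 0; 0; 0; 0].
  by rewrite /words /= (size0nil (size_enum_ord 0)).
case: (posnP l) => [l0|l_gt0].
  have n0 : n = 0 by rewrite /n l0 muln0.
  have ks0 : size ks = 0 by rewrite /ks n0.
  have -> : #|kept_vertices (parameter b) I| = 0.
    by rewrite /kept_vertices kept_set_no_layer ?cards0.
  by rewrite ks0.
rewrite size_ks // -/kept_n -/l -mulnn -/X; case: eqP => // _; case: ifP => _.
  exact: trivial_no_words.
by rewrite reduced_words // size_ks.
Qed.

Lemma program_correct : exists t s,
  [/\ exec (word_bound 300 I) (program b) (initial I) t s,
      outputs s (kernel (parameter b) I)
    & t <= 1000 * (l * nvert I ^ 3).+1].
Proof.
have [nS lnS lnnS lS XS] := S_bounds.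
have N_gt1 : 1 < N by rewrite /N; lia.
have ltN x : x < N -> x < S.
  by move=> xN; apply: leq_trans xN _; rewrite -{1}(expn1 N) leq_exp2l.
have [v [u [q [d [a [bd [bf rk]]]]]]] :=
  @runs_kept n l X word_adj N 300 N_gt1 isT nS lnS m0 (K + n) K 0 erefl word_matrix.
have size_ks_n : size ks <= n.
  by rewrite size_filter (leq_trans (count_size _ _)) ?size_iota.
have ks_n : all (gtn n) ks.
  by apply/allP => w; rewrite mem_filter mem_iota => /andP[_].
have [|||vs' [m' [ro out_o out_m]]] :=
  @runs_output n l X word_adj N 300 N_gt1 isT nS lnS m0 K (K + n) ks
    (budget I) (distance I) erefl erefl word_matrix size_ks_n ks_n erefl erefl
    _ _ lS _ words_past v u q d a bd bf.
- by apply: ltN; rewrite /N; lia.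
- by apply: ltN; rewrite /N; lia.
- by rewrite -/S; lia.
have regs0 : regs (initial I) =1 nth 0 (nseq 14 0) by move=> i; rewrite nth_nseq if_same.
have small0 : small N 5 (nth 0 (nseq 14 0)) m0.
  by split=> i; [rewrite -regs0 expn_gt0 ltnW|exact: words_small].
have [/(_ (initial I) regs0 (frefl _) small0)] := runs_seq runs_setup (runs_seq rk ro).
case=> t [s [ex le_t rs ms _]].
exists t, s; split=> //.
  by move=> i lt_i; rewrite rs out_o ms out_m -kernel_words.
apply: leq_trans le_t _.
have nN : n <= nvert I by rewrite /n; case: (0 < l); lia.
apply: (@leq_trans (1000 * (l * n ^ 3).+1)); last first.
  by rewrite leq_mul2l ltnS leq_mul2l leq_exp2r // nN orbT.
rewrite !expnS expn0 muln1; case: (posnP n) => [->|n_gt0]; first by lia.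
(* Since [n] is 0 without layers, [n > 0] yields a layer, and the terms in [n * n] and [n] are
   absorbed by [l * n ^ 3]. *)
have l_gt0 : 0 < l by move: n_gt0; rewrite /n muln_gt0 lt0b => /andP[].
have lnnn : n * n <= l * (n * (n * n)) by rewrite (leq_trans _ (leq_pmull _ l_gt0)) // leq_pmull.
have nn : n <= n * n by exact: leq_pmull.
have lnn : l * (n * n) <= l * (n * (n * n)) by rewrite leq_mul2l leq_pmull ?orbT.
have -> : n * (n * (l * n * 150 + 100) + 150) =
    150 * (l * (n * (n * n))) + 100 * (n * n) + 150 * n by nia.
lia.
Qed.

End Correctness.

(** * The size bound and the two kernels *)

Lemma size_words_leq I : size (words I) <= encoding_size I.
Proof.
rewrite -sum1_size /encoding_size; apply: leq_sum => w _; exact: ltn0Sn.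
Qed.

(** The [l] matrices on at most [8 * l * X ^ 2] vertices take [64 * (l ^ 3 * X ^ 4)] bits; the
    header is of lower order, and the trivial instances have constant size. *)
Lemma kernel_size b I : encoding_size (kernel (parameter b) I) <=
  200 * (nlayer I ^ 3 * parameter b I ^ 4).+1.
Proof.
set l := nlayer I; set X := parameter b I.
rewrite /kernel; case: eqP => [_|/eqP S0].
  by apply: leq_trans (encoding_size_leq _) _; rewrite /=; lia.
case: ltnP => [_|leS].
  by apply: leq_trans (encoding_size_leq _) _; rewrite /=; lia.
apply: leq_trans (encoding_size_leq _) _; rewrite /=.
move: leS S0; set s := #|_|; rewrite -/l -/X -lt0n => leS s_gt0.
(* A nonempty kept set below the threshold rules out [l = 0] and [X = 0]. *)
have [l_gt0 X_gt0] : 0 < l /\ 0 < X.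
  by split; rewrite lt0n; apply: contraTneq leS => ->; rewrite -ltnNge; lia.
have leX x : x <= l * X ^ 2 -> x <= l ^ 3 * X ^ 4.
  move/leq_trans; apply; rewrite !expnS expn0 !muln1.
  by apply: leq_mul; [rewrite leq_pmulr ?muln_gt0 ?l_gt0|
    rewrite leq_mul2l leq_pmulr ?muln_gt0 ?X_gt0 ?orbT].
have lX : l <= l * X ^ 2 by rewrite leq_pmulr // expn_gt0 X_gt0.
have XX : X <= l * X ^ 2.
  by rewrite -mulnn mulnA leq_pmull // muln_gt0 l_gt0.
have [kX dX] : budget I <= X /\ distance I <= X.
  rewrite /X /parameter; split; first exact: leq_addr.
  apply: leq_trans (leq_addl _ _); apply: leq_pmulr.
  by rewrite /multiplier; case: ifP.
have := leX _ lX; have := leX _ (leq_trans kX XX); have := leX _ (leq_trans dX XX).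
have := leX _ (leqnn _).
have : l * (s * s) <= 64 * (l ^ 3 * X ^ 4).
  apply: (@leq_trans (l * ((8 * l * X ^ 2) * (8 * l * X ^ 2)))).
    by rewrite leq_mul2l leq_mul ?orbT.
  by rewrite !expnS expn0; nia.
set Y := l ^ 3 * X ^ 4; lia.
Qed.

Section Admits.
Variables (b : bool) (Q : instance -> Prop) (H : nat -> Type).
Variable R : forall l, H l -> 'I_l -> 'I_l -> Prop.
Hypothesis QE : forall I,
  Q I <-> solvable (@layer I) (@R (nlayer I)) (budget I) (distance I).
Hypothesis R_total : forall V l (G : 'I_l -> graph V) M d, 0 < l ->
  consistent_along G (@R l) d M -> totally_consistent G M (d * multiplier b l).

Lemma kernel_admitted : admits_kernel Q
  (fun k d l => l ^ 3 * (k + d * multiplier b l) ^ 4) (fun n l => l * n ^ 3).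
Proof.
exists (kernel (parameter b)), (fun I => 1000 * (nlayer I * nvert I ^ 3).+1); split.
- split.
  + by exists (program b), 300 => I; exact: program_correct.
  (* The exponent 2 suffices because the encoding has more than [l * n ^ 2] words, and
     [l * n ^ 3 <= (l * n ^ 2) ^ 2]. *)
  + exists 2, 1000 => I; rewrite leq_mul2l ltnS /=.
    apply: leq_trans (_ : size (words I) ^ 2 <= _); last by rewrite leq_exp2r ?size_words_leq.
    rewrite words_size !expnS expn0 !muln1.
    case: (posnP (nlayer I)) => [->|l_gt0] //.
    rewrite mulnCA mulnC; apply: leq_mul; first by rewrite leq_addl.
    apply: leq_trans (leq_addl _ _); apply: leq_trans (leq_pmull _ l_gt0).
    by case: (nvert I) => // n; rewrite leq_pmull.
  by move=> I; apply: (kernel_equiv _ _ QE R_total) => // l; rewrite /multiplier; case: ifP.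
- by exists 200 => I; exact: kernel_size.
by exists 1000 => I.
Qed.

End Admits.

Lemma edges_outsideS (V : finType) (D D' : {set V}) E E' : D \subset D' ->
  edges_outside D E = edges_outside D E' -> edges_outside D' E = edges_outside D' E'.
Proof.
move=> sub eqE; apply/setP => e; rewrite !inE.
case: (boolP (e \subset ~: D')) => [eD'|_]; last by rewrite !andbF.
have eD : e \subset ~: D by apply: subset_trans eD' _; rewrite setCS.
by move/setP/(_ e): eqE; rewrite !inE eD.
Qed.

Definition same_layers (l : nat) (_ : unit) (i j : 'I_l) : Prop := True.

Definition consecutive (l : nat) (h : 'I_l.-1) (i j : 'I_l) : Prop :=
  i = h :> nat /\ j = h.+1 :> nat.

(** Outside the union, agreement of consecutive layers chains every layer back to layer 0; there are
    [l.-1] deletion sets, at most [l]. *)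
Lemma consecutive_total (V : finType) l (G : 'I_l -> graph V) M d : 0 < l ->
  consistent_along G (@consecutive l) d M -> totally_consistent G M (d * l).
Proof.
move=> l_gt0 [D leD consD]; exists (\bigcup_h D h).
  apply: leq_trans (card_bigcup_leq (m := d) _) _ => //.
  by rewrite card_ord mulnC leq_mul2l leq_pred orbT.
pose i0 : 'I_l := Ordinal l_gt0.
suff eq0 (i : 'I_l) : edges_outside (\bigcup_h D h) (edited G M i)
    = edges_outside (\bigcup_h D h) (edited G M i0) by move=> i j; rewrite !eq0.
case: i => i; elim: i => [|i IHi] lt_i.
  by congr (edges_outside _ (edited _ _ _)); exact: val_inj.
rewrite -(IHi (ltnW lt_i)); symmetry.
have lt_h : i < l.-1 by lia.
apply: (@edges_outsideS _ (D (Ordinal lt_h))); last exact: consD.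
exact: bigcup_sup.
Qed.

Theorem theorem4 :
  admits_kernel MLCE
    (fun k d l : nat => l ^ 3 * (k + d) ^ 4) (fun n l : nat => l * n ^ 3) /\
  admits_kernel TCE
    (fun k d l : nat => l ^ 3 * (k + d * l) ^ 4) (fun n l : nat => l * n ^ 3).
Proof.
split.
  have [|V l G M d _ [D leD consD]|f [t [ker sz tm]]] :=
    @kernel_admitted false MLCE (fun=> unit) same_layers.
  - move=> I; split=> [[M [clM leM [D leD consD]]]|[M [clM leM [D leD consD]]]].
      by exists M; split=> //; exists (fun=> D) => // h i j _; exact: consD.
    by exists M; split=> //; exists (D tt) => // i j; exact: (consD tt).
  - by exists (D tt); rewrite ?muln1 // => i j; exact: (consD tt).
  exists f, t; split=> //; case: sz => C szC; exists C => I.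
  by have := szC I; rewrite /multiplier muln1.
apply: (@kernel_admitted true TCE (fun l => 'I_l.-1) consecutive); last exact: consecutive_total.
move=> I; split=> [[M [clM leM [D leD consD]]]|[M [clM leM [D leD consD]]]].
  by exists M; split=> //; exists D => // h i j [ih jh]; exact: consD.
by exists M; split=> //; exists D => // h i j ih jh; exact: (consD h).
Qed.
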